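(* Let $\phi:X\to Y$ be a non-singular double cover with $\phi_*\mathcal{O}_X\cong\mathcal{O}_Y\oplus\mathcal{O}_Y(-L)$ for a divisor $L$ on $Y$. Let $\mathcal{L}_1,\dots,\mathcal{L}_m$ be line bundles on $X$. Then there exist an affine open covering $\{U_i\}_{i\in I}$ of $Y$ and matrices $K_{ij}^{(k)+},K_{ij}^{(k)-}\in\mathrm{GL}(2,\mathcal{O}_{U_i\cap U_j})$ for all $i,j\in I$ and $k=1,\dots,m$ such that, for all $n_1,\dots,n_m\in\mathbb{Z}$, the matrices $$\left(K_{ij}^{(1)}(n_1)\right)^{|n_1|}\cdots\left(K_{ij}^{(m)}(n_m)\right)^{|n_m|}\begin{pmatrix} 1 & 0 \\ 0 & \xi_{ij} \end{pmatrix}\in\mathrm{GL}(2,\mathcal{O}_{U_i\cap U_j})\qquad(i,j\in I)$$ form transition functions of $\phi_*(\mathcal{L}_1^{n_1}\otimes\cdots\otimes\mathcal{L}_m^{n_m})$, where $K_{ij}^{(k)}(n_k):=K_{ij}^{(k)+}$ if $n_k\ge 0$, $K_{ij}^{(k)}(n_k):=K_{ij}^{(k)-}$ if $n_k<0$, and $\xi_{ij}\in\Gamma(U_i\cap U_j,\mathcal{O}_Y^\times)$ are transition functions of $\mathcal{O}_Y(-L)$. Moreover, such matrices are given explicitly as follows: if $(\{G_{ij}^{(k)}\},\{M_i^{(k)}\})$ is a good representation, over the (common) covering $\{U_i\}_{i\in I}$, of the admissible pair $(\phi_*\mathcal{L}_k,M_{\mathcal{L}_k})$ for each $k=1,\dots,m$,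 with $$G_{ij}^{(k)}=\begin{pmatrix} g_{ij,11}^{(k)} & g_{ij,12}^{(k)} \\ g_{ij,21}^{(k)} & g_{ij,22}^{(k)} \end{pmatrix},\qquad M_i^{(k)}=\begin{pmatrix} a_{i0}^{(k)} & a_{i2}^{(k)} \\ a_{i1}^{(k)} & -a_{i0}^{(k)} \end{pmatrix},\qquad M_i^{(0)}:=\begin{pmatrix} 0 & F_i \\ 1 & 0 \end{pmatrix},$$ then one can take $$K_{ij}^{(k)+}=\frac{1}{a_{i1}^{(k)}}\Big(\big(a_{i1}^{(k)}g_{ij,11}^{(k)}-a_{i0}^{(k)}g_{ij,21}^{(k)}\big)E+g_{ij,21}^{(k)}M_i^{(0)}\Big),$$ $$K_{ij}^{(k)-}=\frac{\xi_{ij}}{a_{i1}^{(k)}\det(G_{ij}^{(k)})}\Big(\big(a_{i1}^{(k)}g_{ij,11}^{(k)}-a_{i0}^{(k)}g_{ij,21}^{(k)}\big)E-g_{ij,21}^{(k)}M_i^{(0)}\Big).$$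
   Context: All varieties are over $\mathbb{C}$. A non-singular double cover is a finite surjective morphism $\phi:X\to Y$ of degree $2$ between non-singular varieties. Let $B_\phi\subset Y$ be its branch locus, $R_\phi\subset X$ its ramification locus, and $F\in H^0(Y,\mathcal{O}_Y(B_\phi))$ a section defining $B_\phi$. The divisor $L$ on $Y$ satisfies $2L\sim B_\phi$, $\phi_*\mathcal{O}_X\cong\mathcal{O}_Y\oplus\mathcal{O}_Y(-L)$ as $\mathcal{O}_Y$-modules, and $\phi_*\mathcal{O}_X\cong\big(\bigoplus_{n\ge0}t^n\mathcal{O}_Y(-nL)\big)/(t^2-F)$ as $\mathcal{O}_Y$-algebras, where $t$ corresponds to a section of $\mathcal{O}_X(R_\phi)$ defining $R_\phi$. $E$ is the $2\times2$ identity matrix. A 2-bundle is a vector bundle of rank $2$; $\mathcal{M}(-L):=\mathcal{M}\otimes\mathcal{O}_Y(-L)$. Admissible pairs: an admissible pair for $\phi$ is a pair $(\mathcal{M},M)$ of a 2-bundle $\mathcal{M}$ on $Y$ and a morphism $M:\mathcal{M}(-L)\to\mathcal{M}$ with $M^2=F\cdot\mathrm{id}_{\mathcal{M}}$, i.e. the composition $\mathcal{M}(-2L)\xrightarrow{M(-L)}\mathcal{M}(-L)\xrightarrow{M}\mathcal{M}$ is multiplication by $F$. For a line bundle $\mathcal{L}$ on $X$, multiplication by $t$ gives $M_{\mathcal{L}}:\phi_*\mathcal{L}(-L)\to\phi_*\mathcal{L}$, and $(\phi_*\mathcal{L},M_{\mathcal{L}})$ is an admissible pair. Representations: let $\{U_i\}_{i\in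 I}$ be an affine open covering of $Y$ with $\phi_*\mathcal{O}_X|_{U_i}\cong\mathcal{O}_{U_i}\oplus\mathcal{O}_{U_i}t_i$ as algebras, $t_i:=t|_{U_i}$, and isomorphisms $\varphi_i:\mathcal{M}|_{U_i}\to\mathcal{O}_{U_i}^{\oplus2}$. Then $t_j=t_i\xi_{ij}$, where $\xi_{ij}$ are the transition functions of $\mathcal{O}_Y(-L)$ (from the trivialization on $U_j$ to that on $U_i$), and $F_i:=F|_{U_i}=t_i^2$. Put $G_{ij}:=\varphi_i\circ\varphi_j^{-1}\in\mathrm{GL}(2,\mathcal{O}_{U_i\cap U_j})$ (transition functions of $\mathcal{M}$, so $G_{ij}G_{jk}=G_{ik}$ and $G_{ii}=E$), and let $M_i:=\varphi_i\circ M\circ(\varphi_i(-L))^{-1}=\begin{pmatrix} a_{i0} & a_{i2} \\ a_{i1} & -a_{i0} \end{pmatrix}$ be the matrix of $M$ on $U_i$; it satisfies $a_{i0}^2+a_{i1}a_{i2}=F_i$ and $M_j=\xi_{ij}G_{ij}^{-1}M_iG_{ij}$. The pair $(\{G_{ij}\},\{M_i\})$ is called a representation of $(\mathcal{M},M)$; it is good if $a_{i1}$ is a unit on $U_i$ for every $i\in I$. *)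

(* Defs.v *)
From HB Require Import structures.
From mathcomp Require Import all_boot all_order all_algebra.
From mathcomp Require Import all_classical all_reals topology.
From mathcomp Require Import complex.
(* mpoly is not imported: its notations clash with those of topology. *)
From mathcomp Require mpoly.

Set Implicit Arguments.
Unset Strict Implicit.
Unset Printing Implicit Defensive.

Import Order.TTheory GRing.Theory Num.Theory.
Local Open Scope classical_set_scope.
Local Open Scope ring_scope.

(* Varieties are classical ones, i.e. spaces with functions over an
   algebraically closed field k, locally isomorphic to closed algebraic subsets
   of k^n.  A regular function on an open set U is represented by a total
   function X -> k of which only the values on U matter: the ring O_X(U) is
   [set f | regfun U f] modulo equality on U.  Nothing is required of
   [regfun U] when U is not open. *)
Record fun_space (k : closedFieldType) := FunSpace {
  fs_top :> topologicalType;
  regfun : set fs_top -> set (fs_top -> k);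
  regfun_eq : forall U f g,
    open U -> {in U, f =1 g} -> regfun U f -> regfun U g;
  regfun_cst : forall U c, open U -> regfun U (fun=> c);
  regfun_add : forall U f g, open U ->
    regfun U f -> regfun U g -> regfun U (fun x => f x + g x);
  regfun_mul : forall U f g, open U ->
    regfun U f -> regfun U g -> regfun U (fun x => f x * g x);
  regfun_sub : forall U V f, open U -> open V -> V `<=` U ->
    regfun U f -> regfun V f;
  regfun_local : forall U f, open U ->
    (forall x, U x -> exists V, [/\ open V, V x, V `<=` U & regfun V f]) ->
    regfun U f }.

Arguments regfun {k} X U _ : rename.

Record morphism (k : closedFieldType) (X Y : fun_space k) := Morphism {
  morph_fun :> X -> Y;
  morph_continuous : continuous morph_fun;
  morph_regfun : forall V f, open V -> regfun Y V f ->
    regfun X (morph_fun @^-1` V) (f \o morph_fun) }.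

Section Spaces.
Variables (k : closedFieldType) (X : fun_space k).
Implicit Types (x : X) (U V W Z : set X) (f g h : X -> k).

Definition zero_locus n (S : set (mpoly.mpoly n k)) : set ('I_n -> k) :=
  [set v | forall p, S p -> mpoly.meval v p = 0].

(* U is isomorphic, through the coordinates c, to the closed algebraic subset
   zero_locus S of k^n, with its Zariski topology and the structure sheaf whose
   sections on D(p) are k[zero_locus S]_p. *)
Definition affine_open U : Prop := open U /\
  exists n (c : X -> 'I_n -> k) (S : set (mpoly.mpoly n k)),
  let D (p : mpoly.mpoly n k) := U `&` [set x | mpoly.meval (c x) p != 0] in
  [/\ {in U &, injective c},
      c @` U = zero_locus S,
      forall V, V `<=` U ->
        (open V <-> forall x, V x -> exists p, D p x /\ D p `<=` V)
    & forall p f, regfun X (D p) f <->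
        exists q N, {in D p, f =1 fun x =>
                     mpoly.meval (c x) q / mpoly.meval (c x) p ^+ N}].

Definition affine_cover I (U : I -> set X) : Prop :=
  (forall i, affine_open (U i)) /\ \bigcup_i U i = setT.

Definition irreducible (A : set X) : Prop :=
  A !=set0 /\ forall F G, closed F -> closed G ->
    A `<=` F `|` G -> A `<=` F \/ A `<=` G.

Definition unit_on U f : Prop :=
  regfun X U f /\ exists2 g, regfun X U g & {in U, forall x, f x * g x = 1}.

(* K \in GL(r, O_X(U)) *)
Definition GL_on r U (K : X -> 'M[k]_r) : Prop :=
  (forall a b, regfun X U (fun x => K x a b)) /\
  exists2 K' : X -> 'M[k]_r, forall a b, regfun X U (fun x => K' x a b)
    & {in U, forall x, K x *m K' x = 1%:M}.

Definition germ x f : Prop := exists U, [/\ open U, U x & regfun X U f].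
Definition max_germ x f : Prop := germ x f /\ f x = 0.

Definition chain_at x d : Prop := exists Z : nat -> set X,
  (forall i, (i <= d)%N -> [/\ closed (Z i), irreducible (Z i) & Z i x]) /\
  (forall i, (i < d)%N -> Z i `<` Z i.+1).

Definition dim_at x d : Prop := chain_at x d /\ ~ chain_at x d.+1.

(* The local ring at x is regular: its maximal ideal has dim_at x generators. *)
Definition nonsingular_at x : Prop := exists d, dim_at x d /\
  exists g : 'I_d -> X -> k, (forall i, max_germ x (g i)) /\
    forall f, max_germ x f -> exists2 h : 'I_d -> X -> k,
      forall i, germ x (h i)
      & \forall y \near x, f y = \sum_(i < d) h i y * g i y.

Definition nonsingular : Prop := forall x, nonsingular_at x.

(* A rational function is a function regular on a nonempty open set, modulo
   equality on a nonempty open set (X is irreducible when this is used). *)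
Definition rational f : Prop :=
  exists U, [/\ open U, U !=set0 & regfun X U f].
Definition rational_eq f g : Prop :=
  exists U, [/\ open U, U !=set0 & {in U, f =1 g}].

(* On U, the ideal of functions vanishing on Z is generated by f. *)
Definition cuts_out U f Z : Prop := regfun X U f /\
  forall V, open V -> V `<=` U -> forall g, regfun X V g ->
    ({in V `&` Z, forall x, g x = 0} <->
     exists2 h, regfun X V h & {in V, forall x, g x = f x * h x}).

End Spaces.

Definition separated (k : closedFieldType) (X : fun_space k) : Prop :=
  forall (Z : fun_space k) (f g : morphism Z X),
    affine_open [set: Z] -> closed [set z | f z = g z].

Record variety (k : closedFieldType) := Variety {
  var_space :> fun_space k;
  var_irreducible : irreducible [set: var_space];
  var_affine_cover : exists n (U : 'I_n -> set var_space), affine_cover U;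
  var_separated : separated var_space }.

Section Morphisms.
Variables (k : closedFieldType) (X Y : fun_space k) (phi : morphism X Y).

Definition finite_morphism : Prop := forall y : Y, exists V,
  [/\ V y, affine_open V, affine_open (phi @^-1` V) &
      exists n (b : 'I_n -> X -> k),
      (forall i, regfun X (phi @^-1` V) (b i)) /\
      forall f, regfun X (phi @^-1` V) f ->
        exists2 a : 'I_n -> Y -> k, forall i, regfun Y V (a i)
        & {in phi @^-1` V, forall x, f x = \sum_(i < n) a i (phi x) * b i x}].

(* [k(X) : k(Y)] = d *)
Definition has_degree d : Prop := exists u : 'I_d -> X -> k,
  [/\ forall i, rational (u i),
      forall f : X -> k, rational f ->
        exists2 a : 'I_d -> Y -> k, forall i, rational (a i)
        & rational_eq f (fun x => \sum_(i < d) a i (phi x) * u i x)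
    & forall a : 'I_d -> Y -> k, (forall i, rational (a i)) ->
        rational_eq (fun x => \sum_(i < d) a i (phi x) * u i x) (fun=> 0) ->
        forall i, rational_eq (a i) (fun=> 0)].

(* m_x = m_(phi x) O_(X, x); residue fields are all equal to k. *)
Definition unramified_at (x : X) : Prop :=
  forall f, max_germ x f -> exists n (g : 'I_n -> Y -> k) (h : 'I_n -> X -> k),
    [/\ forall i, max_germ (phi x) (g i), forall i, germ x (h i)
      & \forall z \near x, f z = \sum_(i < n) h i z * g i (phi z)].

Definition ramification_locus : set X := [set x | ~ unramified_at x].
Definition branch_locus : set Y := phi @` ramification_locus.

Definition nonsingular_double_cover : Prop :=
  [/\ nonsingular X, nonsingular Y, finite_morphism,
      range phi = setT & has_degree 2].

End Morphisms.

(* Sheaves of O_X-modules.  [act U f s] is f s for f in O_X(U), and [res U V]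
   is the restriction for V `<=` U; their values in other cases, and the
   sections on sets that are not open, are irrelevant. *)
Record modsheaf (k : closedFieldType) (X : fun_space k) := ModSheaf {
  sec : set X -> zmodType;
  act : forall U, (X -> k) -> sec U -> sec U;
  res : forall U V, sec U -> sec V;
  act_eq : forall U f g (s : sec U),
    open U -> {in U, f =1 g} -> act f s = act g s;
  act1 : forall U (s : sec U), open U -> act (fun=> 1) s = s;
  actM : forall U f g (s : sec U), open U -> regfun X U f -> regfun X U g ->
    act (fun x => f x * g x) s = act f (act g s);
  actDl : forall U f g (s : sec U), open U -> regfun X U f -> regfun X U g ->
    act (fun x => f x + g x) s = act f s + act g s;
  actDr : forall U f (s t : sec U), open U -> regfun X U f ->
    act f (s + t) = act f s + act f t;
  res_id : forall U (s : sec U), open U -> res U s = s;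
  res_comp : forall U V W (s : sec U), open U -> open V -> open W ->
    V `<=` U -> W `<=` V -> res W (res V s) = res W s;
  res_lin : forall U V f (s t : sec U), open U -> open V -> V `<=` U ->
    regfun X U f -> res V (act f s + t) = act f (res V s) + res V t;
  sec_sep : forall U (s t : sec U), open U ->
    (forall x, U x -> exists V, [/\ open V, V x, V `<=` U & res V s = res V t]) ->
    s = t;
  sec_glue : forall (I : Type) U (V : I -> set X) (s : forall i, sec (V i)),
    open U -> (forall i, open (V i)) -> \bigcup_i V i = U ->
    (forall i j, res (V i `&` V j) (s i) = res (V i `&` V j) (s j)) ->
    exists t : sec U, forall i, res (V i) t = s i }.

Arguments sec {k X} E U : rename.
Arguments act {k X E} U f s : rename.
Arguments res {k X E U} V s : rename.

Section Sheaves.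
Variables (k : closedFieldType) (X : fun_space k).
Implicit Types (A B E P Q : modsheaf X) (U V W : set X).

(* e is the image of the standard basis under an isomorphism O_U^r ~ E|_U. *)
Definition frame r E U (e : 'I_r -> sec E U) : Prop :=
  open U /\ forall V, open V -> V `<=` U ->
  (forall s : sec E V, exists2 f : 'I_r -> X -> k,
     forall a, regfun X V (f a) & s = \sum_(a < r) act V (f a) (res V (e a))) /\
  (forall f : 'I_r -> X -> k, (forall a, regfun X V (f a)) ->
     \sum_(a < r) act V (f a) (res V (e a)) = 0 ->
     forall a, {in V, f a =1 fun=> 0}).

Definition frame1 E U (e : sec E U) : Prop := @frame 1 E U (fun=> e).

Definition line_bundle E : Prop :=
  forall x, exists U (e : sec E U), U x /\ frame1 e.

(* If phi_i : E|_(U_i) -> O^r is the trivialization with frame e_i, then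
   G_ij = phi_i o phi_j^-1. *)
Definition transition_by r E I (U : I -> set X)
    (e : forall i, 'I_r -> sec E (U i)) (G : I -> I -> X -> 'M[k]_r) : Prop :=
  [/\ forall i, frame (e i),
      forall i j, GL_on (U i `&` U j) (G i j)
    & forall i j b, res (U i `&` U j) (e j b) =
        \sum_(a < r) act (U i `&` U j) (fun x => G i j x a b)
                                       (res (U i `&` U j) (e i a))].

Definition transition_functions r E I (U : I -> set X)
    (G : I -> I -> X -> 'M[k]_r) : Prop :=
  exists e : forall i, 'I_r -> sec E (U i), transition_by e G.

Definition sheaf_hom A B (h : forall U, sec A U -> sec B U) : Prop :=
  (forall U f s t, open U -> regfun X U f ->
     h U (act U f s + t) = act U f (h U s) + h U t) /\
  (forall U V s, open U -> open V -> V `<=` U ->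
     h V (res V s) = res V (h U s)).

Definition sheaf_bilinear A B P
    (m : forall U, sec A U -> sec B U -> sec P U) : Prop :=
  [/\ forall U f s s' t, open U -> regfun X U f ->
        m U (act U f s + s') t = act U f (m U s t) + m U s' t,
      forall U f s t t', open U -> regfun X U f ->
        m U s (act U f t + t') = act U f (m U s t) + m U s t'
    & forall U V s t, open U -> open V -> V `<=` U ->
        m V (res V s) (res V t) = res V (m U s t)].

(* P is the tensor product of A and B, by the universal property. *)
Definition is_tensor A B P : Prop :=
  exists2 tau : forall U, sec A U -> sec B U -> sec P U,
  sheaf_bilinear tau &
  forall Q (m : forall U, sec A U -> sec B U -> sec Q U), sheaf_bilinear m ->
  (exists2 h : forall U, sec P U -> sec Q U, sheaf_hom h &
     forall U s t, open U -> h U (tau U s t) = m U s t) /\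
  (forall h h' : forall U, sec P U -> sec Q U, sheaf_hom h -> sheaf_hom h' ->
     (forall U s t, open U -> h U (tau U s t) = h' U (tau U s t)) ->
     forall U s, open U -> h U s = h' U s).

(* l is a homomorphism A|_U -> O_U. *)
Definition functional A U (l : forall V, sec A V -> X -> k) : Prop :=
  [/\ forall V s, open V -> V `<=` U -> regfun X V (l V s),
      forall V f s t, open V -> V `<=` U -> regfun X V f ->
        {in V, forall x, l V (act V f s + t) x = f x * l V s x + l V t x}
    & forall V W s, open V -> open W -> V `<=` U -> W `<=` V ->
        {in W, l W (res W s) =1 l V s}].

(* p is a bilinear map A x B -> O_X. *)
Definition pairing A B (p : forall U, sec A U -> sec B U -> X -> k) : Prop :=
  (forall U (s : sec A U), open U -> functional U (fun V => p V (res V s))) /\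
  (forall U (t : sec B U), open U ->
     functional U (fun V s => p V s (res V t))).

(* D is isomorphic to Hom(A, O_X). *)
Definition is_dual A D : Prop :=
  exists2 p : forall U, sec D U -> sec A U -> X -> k, pairing p &
  forall U, open U ->
  (forall l : forall V, sec A V -> X -> k, functional U l ->
     exists d : sec D U, forall V s, open V -> V `<=` U ->
       {in V, p V (res V d) s =1 l V s}) /\
  (forall d : sec D U, (forall V s, open V -> V `<=` U ->
       {in V, p V (res V d) s =1 fun=> 0}) -> d = 0).

(* P is isomorphic to O_X. *)
Definition is_structure_sheaf P : Prop := exists e : sec P setT, frame1 e.

Fixpoint is_tensor_power A n P : Prop :=
  if n is n'.+1 then exists2 Q, is_tensor_power A n' Q & is_tensor Q A P
  else is_structure_sheaf P.

Definition is_power A (n : int) P : Prop :=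
  match n with
  | Posz n => is_tensor_power A n P
  | Negz n => exists2 D, is_dual A D & is_tensor_power D n.+1 P
  end.

Fixpoint is_power_product (s : seq (modsheaf X * int)) P : Prop :=
  if s is (A, n) :: s' then
    exists A' P', [/\ is_power A n A', is_power_product s' P' & is_tensor A' P' P]
  else is_structure_sheaf P.

(* P is isomorphic to L_1^(n_1) (x) ... (x) L_m^(n_m). *)
Definition is_monomial m (L : 'I_m -> modsheaf X) (n : 'I_m -> int) P : Prop :=
  is_power_product [seq (L i, n i) | i <- enum 'I_m] P.

(* Cartier divisors, given by local equations num_a / den_a. *)
Record cartier_divisor := CartierDivisor {
  div_index : Type;
  div_dom : div_index -> set X;
  div_num : div_index -> X -> k;
  div_den : div_index -> X -> k;
  div_open : forall a, open (div_dom a);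
  div_cover : \bigcup_a div_dom a = setT;
  div_num_reg : forall a, regfun X (div_dom a) (div_num a);
  div_den_reg : forall a, regfun X (div_dom a) (div_den a);
  div_num_neq0 : forall a, exists2 x, div_dom a x & div_num a x != 0;
  div_den_neq0 : forall a, exists2 x, div_dom a x & div_den a x != 0;
  div_compat : forall a b, exists2 u, unit_on (div_dom a `&` div_dom b) u &
    {in div_dom a `&` div_dom b, forall x,
      div_num b x * div_den a x = u x * (div_num a x * div_den b x)} }.

(* N is isomorphic to O_X(- L): if f_a is the local equation of L on U_a, then
   O_X(- L) has the frame f_a on U_a, and f_b = (f_b / f_a) f_a. *)
Definition is_O_minus (L : cartier_divisor) (N : modsheaf X) : Prop :=
  exists2 u : div_index L -> div_index L -> X -> k,
    forall a b, {in div_dom a `&` div_dom b, forall x,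
      div_num b x * div_den a x = u a b x * (div_num a x * div_den b x)}
    & transition_functions N (@div_dom L) (fun a b x => (u a b x)%:M : 'M_1).

End Sheaves.

Section Pushforward.
Variables (k : closedFieldType) (X Y : fun_space k) (phi : morphism X Y).
Variable E : modsheaf X.

Let pre (V : set Y) : set X := phi @^-1` V.

Let open_pre V : open V -> open (pre V).
Proof. by move=> oV; apply: open_comp => // x _; exact: morph_continuous. Qed.

Let sub_pre (V W : set Y) : W `<=` V -> pre W `<=` pre V.
Proof. by move=> WV x /WV. Qed.

Let eq_pre V (f g : Y -> k) :
  {in V, f =1 g} -> {in pre V, f \o phi =1 g \o phi}.
Proof. by move=> fg x; rewrite inE => Vx /=; apply: fg; rewrite inE. Qed.

Let psec V : zmodType := sec E (pre V).
Let pact V (f : Y -> k) (s : psec V) : psec V := act (pre V) (f \o phi) s.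
Let pres V W (s : psec V) : psec W := res (pre W) s.

Fact push_act_eq V f g (s : psec V) :
  open V -> {in V, f =1 g} -> pact f s = pact g s.
Proof. by move=> oV fg; apply: act_eq; [exact: open_pre|exact: eq_pre]. Qed.

Fact push_act1 V (s : psec V) : open V -> pact (fun=> 1) s = s.
Proof. by move=> oV; apply: act1; exact: open_pre. Qed.

Fact push_actM V f g (s : psec V) : open V -> regfun Y V f -> regfun Y V g ->
  pact (fun y => f y * g y) s = pact f (pact g s).
Proof.
by move=> oV rf rg; apply: actM; [exact: open_pre|exact: morph_regfun..].
Qed.

Fact push_actDl V f g (s : psec V) : open V -> regfun Y V f -> regfun Y V g ->
  pact (fun y => f y + g y) s = pact f s + pact g s.
Proof.
by move=> oV rf rg; apply: actDl; [exact: open_pre|exact: morph_regfun..].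
Qed.

Fact push_actDr V f (s t : psec V) : open V -> regfun Y V f ->
  pact f (s + t) = pact f s + pact f t.
Proof. by move=> oV rf; apply: actDr; [exact: open_pre|exact: morph_regfun]. Qed.

Fact push_res_id V (s : psec V) : open V -> pres V s = s.
Proof. by move=> oV; apply: res_id; exact: open_pre. Qed.

Fact push_res_comp U V W (s : psec U) : open U -> open V -> open W ->
  V `<=` U -> W `<=` V -> pres W (pres V s) = pres W s.
Proof.
by move=> oU oV oW VU WV; apply: res_comp; do ?[exact: open_pre|exact: sub_pre].
Qed.

Fact push_res_lin U V f (s t : psec U) : open U -> open V -> V `<=` U ->
  regfun Y U f -> pres V (pact f s + t) = pact f (pres V s) + pres V t.
Proof.
move=> oU oV VU rf.
by apply: res_lin; do ?[exact: open_pre|exact: sub_pre|exact: morph_regfun].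
Qed.

Fact push_sec_sep U (s t : psec U) : open U ->
  (forall y, U y -> exists V, [/\ open V, V y, V `<=` U & pres V s = pres V t]) ->
  s = t.
Proof.
move=> oU st; apply: (sec_sep (open_pre oU)) => x /st[V [oV Vx VU stV]].
by exists (pre V); split; [exact: open_pre| |exact: sub_pre|].
Qed.

Fact push_sec_glue (I : Type) U (V : I -> set Y) (s : forall i, psec (V i)) :
  open U -> (forall i, open (V i)) -> \bigcup_i V i = U ->
  (forall i j, pres (V i `&` V j) (s i) = pres (V i `&` V j) (s j)) ->
  exists t : psec U, forall i, pres (V i) t = s i.
Proof.
move=> oU oV VU ss.
apply: (sec_glue (V := fun i => pre (V i)) (open_pre oU)) => //.
- by move=> i; exact: open_pre.
- by rewrite -VU /pre preimage_bigcup.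
Qed.

Definition pushforward : modsheaf Y :=
  ModSheaf push_act_eq push_act1 push_actM push_actDl push_actDr
    push_res_id push_res_comp push_res_lin push_sec_sep push_sec_glue.

End Pushforward.

Section DoubleCover.
Variables (k : closedFieldType) (X Y : fun_space k) (phi : morphism X Y).

(* For N = O_Y(- L), the isomorphism of O_Y-algebras
     phi_* O_X ~ (sum_n t^n O_Y(- n L)) / (t^2 - F) = O_Y + t O_Y(- L).
   [tau nu] is t nu, and F, a global section of O_Y(2 L), is seen as the
   bilinear map (nu, nu') |-> F nu nu' from N x N to O_Y. *)
Record double_cover_structure (N : modsheaf Y) := DoubleCoverStructure {
  tau : forall V, sec N V -> X -> k;
  branch_eq : forall V, sec N V -> sec N V -> Y -> k;
  tau_regfun : forall V nu, open V -> regfun X (phi @^-1` V) (@tau V nu);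
  tau_lin : forall V f nu nu', open V -> regfun Y V f ->
    {in phi @^-1` V, forall x,
       @tau V (act V f nu + nu') x = f (phi x) * @tau V nu x + @tau V nu' x};
  tau_res : forall V W nu, open V -> open W -> W `<=` V ->
    {in phi @^-1` W, @tau W (res W nu) =1 @tau V nu};
  branch_eq_pairing : pairing branch_eq;
  tau_split : forall V f, open V -> regfun X (phi @^-1` V) f ->
    exists a nu, regfun Y V a /\
      {in phi @^-1` V, forall x, f x = a (phi x) + @tau V nu x};
  tau_direct : forall V a nu, open V -> regfun Y V a ->
    {in phi @^-1` V, forall x, a (phi x) + @tau V nu x = 0} ->
    {in V, a =1 fun=> 0} /\ nu = 0;
  tau_mul : forall V nu nu', open V ->
    {in phi @^-1` V, forall x,
      @tau V nu x * @tau V nu' x = @branch_eq V nu nu' (phi x)};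
  tau_ramification : forall V nu, frame1 nu ->
    cuts_out (phi @^-1` V) (@tau V nu) (ramification_locus phi);
  branch_eq_branch : forall V nu, frame1 nu ->
    cuts_out V (@branch_eq V nu nu) (branch_locus phi) }.

Definition mx2 (a b c d : k) : 'M[k]_2 :=
  \matrix_(i, j) nth 0 (nth [::] [:: [:: a; b]; [:: c; d]] i) j.

Variables (N : modsheaf Y) (D : double_cover_structure N).

(* A morphism E(- L) = E (x) N -> E is seen as a bilinear map N x E -> E; this
   is the one for E = phi_* L given by the multiplication by t. *)
Definition mul_t (L : modsheaf X) V (nu : sec N V)
    (s : sec (pushforward phi L) V) : sec (pushforward phi L) V :=
  act (phi @^-1` V) (tau D nu) s.

Section Representation.
Variables (I : Type) (U : I -> set Y) (nu : forall i, sec N (U i)).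

(* ({G_ij}, {M_i}), with M_i = (a0_i, a2_i; a1_i, - a0_i), is a representation
   of the admissible pair (E, M), the trivialization of N on U_i being the one
   with frame nu_i (so t_i = tau nu_i). *)
Definition representation (E : modsheaf Y)
    (M : forall V, sec N V -> sec E V -> sec E V)
    (G : I -> I -> Y -> 'M[k]_2) (a0 a1 a2 : I -> Y -> k) : Prop :=
  exists e : forall i, 'I_2 -> sec E (U i),
  [/\ transition_by e G,
      forall i, [/\ regfun Y (U i) (a0 i), regfun Y (U i) (a1 i)
                  & regfun Y (U i) (a2 i)]
    & forall i b, M (U i) (nu i) (e i b) =
        \sum_(a < 2) act (U i)
          (fun y => mx2 (a0 i y) (a2 i y) (a1 i y) (- a0 i y) a b) (e i a)].

Definition good_representation (E : modsheaf Y)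
    (M : forall V, sec N V -> sec E V -> sec E V)
    (G : I -> I -> Y -> 'M[k]_2) (a0 a1 a2 : I -> Y -> k) : Prop :=
  representation M G a0 a1 a2 /\ forall i, unit_on (U i) (a1 i).

(* F_i = t_i^2 *)
Definition F_loc i : Y -> k := branch_eq D (nu i) (nu i).

Definition K_plus (G : I -> I -> Y -> 'M[k]_2)
    (a0 a1 : I -> Y -> k) i j (y : Y) : 'M[k]_2 :=
  (a1 i y)^-1 *:
    ((a1 i y * G i j y 0 0 - a0 i y * G i j y 1 0)%:M
     + G i j y 1 0 *: mx2 0 (F_loc i y) 1 0).

Definition K_minus (xi : I -> I -> Y -> k) (G : I -> I -> Y -> 'M[k]_2)
    (a0 a1 : I -> Y -> k) i j (y : Y) : 'M[k]_2 :=
  (xi i j y / (a1 i y * \det (G i j y))) *: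
    ((a1 i y * G i j y 0 0 - a0 i y * G i j y 1 0)%:M
     - G i j y 1 0 *: mx2 0 (F_loc i y) 1 0).

End Representation.

(* The r-th factor is K^(r)(n_r)^|n_r|; [Kp] and [Km] are K^(r)+ and K^(r)-. *)
Definition present_pushforwards m (L : 'I_m -> modsheaf X)
    I (U : I -> set Y) (xi : I -> I -> Y -> k)
    (Kp Km : 'I_m -> I -> I -> Y -> 'M[k]_2) : Prop :=
  (forall r i j, GL_on (U i `&` U j) (Kp r i j) /\
                 GL_on (U i `&` U j) (Km r i j)) /\
  forall (n : 'I_m -> int) (P : modsheaf X), is_monomial L n P ->
    transition_functions (pushforward phi P) U (fun i j y =>
      (\prod_(r < m) (if 0 <= n r then Kp r i j y else Km r i j y) ^+ `|n r|%N)
      *m mx2 1 0 0 (xi i j y)).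

End DoubleCover.

(* Main.v *)
Require Import Defs.
From HB Require Import structures.
From mathcomp Require Import all_boot all_order all_algebra.
From mathcomp Require Import all_classical all_reals topology.
From mathcomp Require Import complex ring.
(* The notations of mpoly clash with those of topology. *)
From mathcomp Require Import -(notations) mpoly.

Set Implicit Arguments.
Unset Strict Implicit.
Unset Printing Implicit Defensive.

Import Order.TTheory GRing.Theory Num.Theory.
Local Open Scope classical_set_scope.
Local Open Scope ring_scope.

(* Let P be a line bundle on X with frames w_i on W_i = phi^-1 U_i and
   w_j = (p_ij + q_ij t_i) w_i.  Then (w_i, t_i w_i) is a frame of phi_* P, and the
   transition functions are (p_ij E + q_ij M_i^(0)) diag(1, xi_ij), where the first
   factor is the matrix of the multiplication by p_ij + q_ij t_i.  So the product
   of the K's comes from the transition functions of the L_k and of their duals.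
   If a_i1 is a unit, the first vector s_i of the frame of phi_* L_k generates it
   over phi_* O_X, and K^+ is the multiplication by u_ij = s_j / s_i.  The relation
   M_j = xi_ij G_ij^-1 M_i G_ij gives the norm of u_ij, and K^- turns out to be the
   multiplication by u_ij^-1 a_j1 / a_i1, the transition function of the dual in
   the frames a_i1 / s_i.
   That s_i is a frame on all open subsets of W_i, as well as the existence of good
   coverings, follows from the triviality of line bundles near the fibres of phi,
   which consist of two (possibly equal) conjugate points of an affine set. *)

(** A frame of a line bundle is tested on all open subsets of W_i, whereas a frame of phi_* L_k only
    says something about the subsets phi^-1 V. A generator over the latter becomes a frame by
    comparison with a frame already known over some phi^-1 V'. This is why a trivialization near a
    point of X is not enough and one near a whole fibre is needed. The multiplier a_j1 / a_i1 comes
    from the norm: with A = a_i1 g_11 - a_i0 g_21, u_ij = (A + g_21 t_i) / a_i1 has norm a_j1 det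
    G_ij / (xi_ij a_i1), so u_ij^-1 = xi_ij (A - g_21 t_i) / (a_j1 det G_ij). Rescaling the dual
    frames by a_i1 replaces a_j1 by a_i1 in this denominator and leaves the stated K^-. Tensor
    products and duals are known through universal properties only, so that products and inverses of
    transition functions describe them has to be proved: the sections built from frames must be
    shown to be frames again. *)

Lemma addrr_eq0 (V : zmodType) (x : V) : x + x = x -> x = 0.
Proof. by move=> /eqP; rewrite -subr_eq0 addrK => /eqP. Qed.

(** * Regular functions and their inverses *)

Section RegularFunctions.
Variables (k : closedFieldType) (X : fun_space k).
Implicit Types (U V : set X) (f g : X -> k).

Lemma eq_regfun U f g : open U -> (forall x, U x -> f x = g x) ->
  regfun X U f -> regfun X U g.
Proof.
by move=> oU fg; apply: regfun_eq => // x; rewrite inE => Ux; exact: fg.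
Qed.

Lemma regfun_opp U f : open U -> regfun X U f -> regfun X U (fun x => - f x).
Proof.
move=> oU rf; apply: (@eq_regfun U (fun x => -1 * f x)) => //.
  by move=> x _; rewrite mulN1r.
by apply: regfun_mul => //; exact: regfun_cst.
Qed.

Lemma unit_on_neq0 U f x : unit_on U f -> U x -> f x != 0.
Proof.
case=> _ [g _ fg] Ux; apply/eqP => f0; have := fg x; rewrite inE => /(_ Ux).
by move/eqP; rewrite f0 mul0r eq_sym oner_eq0.
Qed.

Lemma unit_on_inv U f :
  open U -> unit_on U f -> regfun X U (fun x => (f x)^-1).
Proof.
move=> oU uf; have [_ [g rg fg]] := uf; apply: (eq_regfun oU _ rg) => x Ux.
apply: (mulfI (unit_on_neq0 uf Ux)); rewrite fg ?inE//.
by rewrite divff// (unit_on_neq0 uf Ux).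
Qed.

End RegularFunctions.

(** * Frames of rank one and coordinates along them *)

Section Frames.
Variables (k : closedFieldType) (X : fun_space k).
Implicit Types (E : modsheaf X) (A B U V W : set X) (f g : X -> k).

Lemma eq_act E U f g (s : sec E U) : open U ->
  (forall x, U x -> f x = g x) -> act U f s = act U g s.
Proof. by move=> oU fg; apply: act_eq => // x; rewrite inE => Ux; exact: fg. Qed.

Lemma act_r0 E U f : open U -> regfun X U f -> act U f (0 : sec E U) = 0.
Proof.
move=> oU rf; have := @actDr _ _ E U f 0 0 oU rf.
by rewrite addr0 => /esym /addrr_eq0.
Qed.

Lemma act_l0 E U f (s : sec E U) : open U -> (forall x, U x -> f x = 0) ->
  act U f s = 0.
Proof.
move=> oU f0; have rc c : regfun X U (fun=> c) by exact: regfun_cst.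
have -> : act U f s = act U (fun=> 0) s by apply: eq_act.
have := @actDl _ _ E U _ _ s oU (rc 0) (rc 0).
rewrite (@eq_act _ _ _ (fun=> 0))// => [|x _]; last by rewrite addr0.
by move=> /esym /addrr_eq0.
Qed.

Lemma act_N E U f (s : sec E U) : open U -> regfun X U f ->
  act U (fun x => - f x) s = - act U f s.
Proof.
move=> oU rf; apply/eqP; rewrite -addr_eq0 -actDl//; last exact: regfun_opp.
by rewrite act_l0// => x _; rewrite addNr.
Qed.

Lemma res_D E U V (s t : sec E U) : open U -> open V -> V `<=` U ->
  res V (s + t) = res V s + res V t.
Proof.
move=> oU oV VU; have := @res_lin _ _ E U V (fun=> 1) s t oU oV VU.
by rewrite !act1//; apply; exact: regfun_cst.
Qed.

Lemma res_0 E U V : open U -> open V -> V `<=` U -> res V (0 : sec E U) = 0.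
Proof.
move=> oU oV VU; have := @res_D E U V 0 0 oU oV VU.
by rewrite addr0 => /esym /addrr_eq0.
Qed.

Lemma res_act E U V f (s : sec E U) : open U -> open V -> V `<=` U ->
  regfun X U f -> res V (act U f s) = act V f (res V s).
Proof.
move=> oU oV VU rf; have := @res_lin _ _ E U V f s 0 oU oV VU rf.
by rewrite addr0 res_0// addr0.
Qed.

Lemma frame1P E U (e : sec E U) : frame1 e <->
  open U /\ forall V, open V -> V `<=` U ->
  (forall s : sec E V,
     exists2 f, regfun X V f & s = act V f (res V e)) /\
  (forall f, regfun X V f -> act V f (res V e) = 0 ->
     forall x, V x -> f x = 0).
Proof.
split=> -[oU eP]; split=> // V oV VU; have [gen indep] := eP _ oV VU; split.
- move=> s; have [f rf ->] := gen s.
  by exists (f ord0); rewrite ?big_ord1.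
- move=> f rf f0 x Vx; apply: (indep (fun=> f)) => //; rewrite ?inE//.
    by rewrite big_ord1.
  exact: ord0.
- move=> s; have [f rf ->] := gen s.
  by exists (fun=> f); rewrite ?big_ord1.
- move=> f rf; rewrite big_ord1 => f0 i x; rewrite inE => Vx.
  by rewrite (ord1 i); exact: (indep (f ord0)).
Qed.

Lemma frame1_open E U (e : sec E U) : frame1 e -> open U.
Proof. by case. Qed.

Section Coordinates.
Variables (E : modsheaf X) (U : set X) (e : sec E U).
Hypothesis fe : frame1 e.

Lemma frame1_inj V f g : open V -> V `<=` U -> regfun X V f -> regfun X V g ->
  act V f (res V e) = act V g (res V e) -> forall x, V x -> f x = g x.
Proof.
move=> oV VU rf rg fg x Vx; have [_ /(_ V oV VU)[_ indep]] := (frame1P e).1 fe.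
have rNg := regfun_opp oV rg.
apply/eqP; rewrite -subr_eq0; apply/eqP.
apply: (indep (fun x => f x - g x)) => //; first exact: regfun_add.
by rewrite actDl// act_N// fg subrr.
Qed.

(** A choice, since [frame1] only asserts existence. It is determined on V; outside V its values are
    arbitrary. *)
Definition fcoef V (s : sec E V) : X -> k :=
  xget (fun=> 0) [set f | regfun X V f /\ s = act V f (res V e)].

Lemma fcoefP V (s : sec E V) : open V -> V `<=` U ->
  regfun X V (fcoef s) /\ s = act V (fcoef s) (res V e).
Proof.
move=> oV VU; have [_ /(_ V oV VU)[gen _]] := (frame1P e).1 fe.
by have [f rf ef] := gen s; exact: (@xgetPex _ (fun=> 0)
  [set f | regfun X V f /\ s = act V f (res V e)] (ex_intro _ f (conj rf ef))).
Qed.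

Lemma fcoef_regfun V (s : sec E V) : open V -> V `<=` U -> regfun X V (fcoef s).
Proof. by move=> oV VU; have [] := fcoefP s oV VU. Qed.

Lemma fcoefE V (s : sec E V) : open V -> V `<=` U ->
  act V (fcoef s) (res V e) = s.
Proof. by move=> oV VU; have [] := fcoefP s oV VU. Qed.

Lemma fcoef_unique V (s : sec E V) f : open V -> V `<=` U -> regfun X V f ->
  s = act V f (res V e) -> forall x, V x -> fcoef s x = f x.
Proof.
move=> oV VU rf ef; apply: frame1_inj => //; first exact: fcoef_regfun.
by rewrite fcoefE.
Qed.

Lemma fcoef_lin V f (s t : sec E V) : open V -> V `<=` U -> regfun X V f ->
  forall x, V x -> fcoef (act V f s + t) x = f x * fcoef s x + fcoef t x.
Proof.
move=> oV VU rf; have [rs rt] := (fcoef_regfun s oV VU, fcoef_regfun t oV VU).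
have rfs := regfun_mul oV rf rs.
apply: fcoef_unique => //; first exact: regfun_add.
by rewrite actDl// actM// !fcoefE.
Qed.

Lemma fcoef_res V W (s : sec E V) : open V -> open W -> V `<=` U -> W `<=` V ->
  forall x, W x -> fcoef (res W s) x = fcoef s x.
Proof.
move=> oV oW VU WV; have WU := subset_trans WV VU.
have rs := fcoef_regfun s oV VU.
apply: fcoef_unique => //; first exact: regfun_sub rs.
have oU := frame1_open fe.
by rewrite -{1}(fcoefE s oV VU) res_act// res_comp.
Qed.

Lemma fcoef_frame V : open V -> V `<=` U ->
  forall x, V x -> fcoef (res V e) x = 1.
Proof.
move=> oV VU; apply: fcoef_unique => //; first exact: regfun_cst.
by rewrite act1.
Qed.

Lemma frame1_res V : open V -> V `<=` U -> frame1 (res V e).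
Proof.
move=> oV VU; have [oU eP] := (frame1P e).1 fe.
apply/frame1P; split=> // W oW WV; rewrite res_comp//.
exact: eP (subset_trans _ VU).
Qed.

Lemma frame1_unit V f : open V -> V `<=` U -> unit_on V f ->
  frame1 (act V f (res V e)).
Proof.
move=> oV VU uf; have oU := frame1_open fe; have [rf _] := uf.
have ri := unit_on_inv oV uf.
apply/frame1P; split=> // W oW WV; have WU := subset_trans WV VU.
have [rfW riW] := (regfun_sub oV oW WV rf, regfun_sub oV oW WV ri).
have fn0 x : W x -> f x != 0 by move/WV; exact: unit_on_neq0.
rewrite res_act// res_comp//; split=> [s|g rg].
  have rs := fcoef_regfun s oW WU.
  exists (fun x => fcoef s x * (f x)^-1); first exact: regfun_mul.
  rewrite -actM//; last exact: regfun_mul.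
  rewrite -{1}(fcoefE s oW WU); apply: eq_act => // x Wx.
  by rewrite divfK// fn0.
have rgf := regfun_mul oW rg rfW.
rewrite -actM// => gf0 x Wx; have [_ /(_ W oW WU)[_ indep]] := (frame1P e).1 fe.
have /eqP := indep _ rgf gf0 x Wx.
by rewrite mulf_eq0 (negPf (fn0 _ Wx)) orbF => /eqP.
Qed.

End Coordinates.

(** Coordinates along a frame are unique, so those found near the various points fit together into
    one regular function, and [sec_sep] identifies the section. *)
Lemma frame1_local E W (e : sec E W) : open W ->
  (forall x, W x -> exists V, [/\ open V, V x, V `<=` W & frame1 (res V e)]) ->
  frame1 e.
Proof.
move=> oW loc; apply/frame1P; split=> // V oV VW.
have eVV' V' : open V' -> V' `<=` W -> res (V `&` V') (res V' e) = res (V `&` V') e.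
  by move=> oV' V'W; rewrite res_comp//; exact: openI.
split=> [s|f rf f0 x Vx]; last first.
  have [V' [oV' V'x V'W fV']] := loc x (VW _ Vx).
  have oI := openI oV oV'.
  have [_ /(_ _ oI (@subIsetr _ _ _))[_ indep]] := (frame1P _).1 fV'.
  apply: (indep f) => //; first by apply: regfun_sub rf => //; exact: subIsetl.
  rewrite eVV'// -[res _ e](@res_comp _ _ _ _ V)//.
  by rewrite -res_act ?f0 ?res_0//; exact: subIsetl.
pose good x f := exists V', [/\ open V', V' x, V' `<=` V, regfun X V' f &
  res V' s = act V' f (res V' e)].
have goodE x y f g : good x f -> good y g ->
    exists A B : set X, [/\ open A, A x, open B, B y &
      forall z, A z -> B z -> f z = g z].
  move=> [A [oA Ax AV rf fA]] [B [oB By BV rg gB]]; exists A, B; split=> //.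
  move=> z Az Bz; have [C [oC Cz CW fC]] := loc z (VW _ (AV _ Az)).
  pose D := A `&` B `&` C.
  have oD : open D by apply: openI => //; exact: openI.
  have DA : D `<=` A by move=> ? [[]].
  have DB : D `<=` B by move=> ? [[]].
  have DC : D `<=` C by move=> ? [].
  have sD (A' : set X) f' : open A' -> D `<=` A' -> A' `<=` V -> regfun X A' f' ->
      res A' s = act A' f' (res A' e) -> res D s = act D f' (res D (res C e)).
    move=> oA' DA' A'V rf' es; rewrite res_comp// -[res D s](res_comp s oV oA')//.
    rewrite es res_act// res_comp//; exact: subset_trans VW.
  apply: (frame1_inj fC oD DC) => //; [exact: regfun_sub rf|exact: regfun_sub rg|].
  by rewrite -(sD A)// -(sD B).
have ex x : V x -> exists f, good x f.
  move=> Vx; have [V' [oV' V'x V'W fV']] := loc x (VW _ Vx).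
  have oI := openI oV oV'.
  exists (fcoef (res V' e) (res (V `&` V') s)), (V `&` V').
  split=> //; [by apply: fcoef_regfun => //; exact: subIsetr|].
  by rewrite -{1}(fcoefE fV' (res (V `&` V') s) oI (@subIsetr _ _ _)) eVV'.
(* The value at x comes from a choice made for x alone. By [goodE] it agrees near x with a single
   local coordinate, hence h is regular. *)
pose h x := xget (fun=> 0) [set f | good x f] x.
have hgood x : V x -> good x (xget (fun=> 0) [set f | good x f]).
  move=> /ex[f gf].
  exact: (@xgetPex _ (fun=> 0) [set f | good x f] (ex_intro _ f gf)).
have local x : V x -> exists A, [/\ open A, A x, A `<=` V, regfun X A h &
    res A s = act A h (res A e)].
  move=> Vx; have gx := hgood _ Vx; set f := xget _ _ in gx.
  have [A [oA Ax AV rf fA]] := gx.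
  have fh y : A y -> f y = h y.
    move=> Ay; have gy := hgood _ (AV _ Ay).
    have gyf : good y f by exists A.
    by have [B [C [oB By oC Cy]]] := goodE _ _ _ _ gyf gy; apply.
  exists A; split=> //; first exact: eq_regfun rf.
  by rewrite fA; exact: eq_act.
have rh : regfun X V h.
  apply: regfun_local => // x /local[A [oA Ax AV rA _]].
  by exists A.
exists h => //; apply: sec_sep => // x /local[A [oA Ax AV rA eA]].
exists A; split=> //; rewrite res_act//.
by rewrite eA res_comp.
Qed.

End Frames.

(* For the inclusion j of an open set U, this is j_* (E|_U). *)
Section OpenPushforward.
Variables (k : closedFieldType) (X : fun_space k) (U : set X).
Hypothesis oU : open U.
Variable E : modsheaf X.

Let jsec V : zmodType := sec E (U `&` V).
Let jact V (f : X -> k) (s : jsec V) : jsec V := act (U `&` V) f s.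
Let jres V W (s : jsec V) : jsec W := res (U `&` W) s.

Let oI V : open V -> open (U `&` V).
Proof. exact: openI. Qed.

Let rI V f : open V -> regfun X V f -> regfun X (U `&` V) f.
Proof. by move=> oV; apply: regfun_sub => //; exact: oI. Qed.

Fact jact_eq V f g (s : jsec V) : open V -> {in V, f =1 g} -> jact f s = jact g s.
Proof.
move=> oV fg; apply: eq_act; first exact: oI.
by move=> x [_ Vx]; apply: fg; rewrite inE.
Qed.

Fact jact1 V (s : jsec V) : open V -> jact (fun=> 1) s = s.
Proof. by move=> oV; apply: act1; exact: oI. Qed.

Fact jactM V f g (s : jsec V) : open V -> regfun X V f -> regfun X V g ->
  jact (fun x => f x * g x) s = jact f (jact g s).
Proof. by move=> oV rf rg; apply: actM; [exact: oI|exact: rI..]. Qed.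

Fact jactDl V f g (s : jsec V) : open V -> regfun X V f -> regfun X V g ->
  jact (fun x => f x + g x) s = jact f s + jact g s.
Proof. by move=> oV rf rg; apply: actDl; [exact: oI|exact: rI..]. Qed.

Fact jactDr V f (s t : jsec V) : open V -> regfun X V f ->
  jact f (s + t) = jact f s + jact f t.
Proof. by move=> oV rf; apply: actDr; [exact: oI|exact: rI]. Qed.

Fact jres_id V (s : jsec V) : open V -> jres V s = s.
Proof. by move=> oV; apply: res_id; exact: oI. Qed.

Fact jres_comp V V' W (s : jsec V) : open V -> open V' -> open W ->
  V' `<=` V -> W `<=` V' -> jres W (jres V' s) = jres W s.
Proof.
by move=> *; apply: res_comp; do ?[exact: oI|exact: setIS].
Qed.

Fact jres_lin V W f (s t : jsec V) : open V -> open W -> W `<=` V ->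
  regfun X V f -> jres W (jact f s + t) = jact f (jres W s) + jres W t.
Proof. by move=> *; apply: res_lin; do ?[exact: oI|exact: setIS|exact: rI]. Qed.

Fact jsec_sep V (s t : jsec V) : open V ->
  (forall x, V x -> exists W, [/\ open W, W x, W `<=` V & jres W s = jres W t]) ->
  s = t.
Proof.
move=> oV st; apply: (sec_sep (oI oV)) => x [Ux /st[W [oW Wx WV stW]]].
by exists (U `&` W); split; [exact: oI| |exact: setIS|].
Qed.

Fact jsec_glue (I : Type) V (W : I -> set X) (s : forall i, jsec (W i)) :
  open V -> (forall i, open (W i)) -> \bigcup_i W i = V ->
  (forall i j, jres (W i `&` W j) (s i) = jres (W i `&` W j) (s j)) ->
  exists t : jsec V, forall i, jres (W i) t = s i.
Proof.
move=> oV oW WV ss.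
apply: (sec_glue (V := fun i => U `&` W i) (oI oV)) => [i||i j].
- exact: oI.
- by rewrite -WV setI_bigcupr.
- by rewrite -setIIr; exact: ss.
Qed.

Definition open_pushforward : modsheaf X :=
  ModSheaf jact_eq jact1 jactM jactDl jactDr jres_id jres_comp jres_lin
    jsec_sep jsec_glue.

End OpenPushforward.

(** * Frames of tensor products and duals, from the universal properties *)

Section Tensor.
Variables (k : closedFieldType) (X : fun_space k).
Implicit Types (E : modsheaf X) (U V W : set X) (f g : X -> k).

Lemma sheaf_bilinear_act A B P (m : forall U, sec A U -> sec B U -> sec P U)
    U f g (s : sec A U) (t : sec B U) : sheaf_bilinear m -> open U ->
  regfun X U f -> regfun X U g ->
  m U (act U f s) (act U g t) = act U (fun x => f x * g x) (m U s t).
Proof.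
move=> [mDl mDr _] oU rf rg.
have m0l s' : m U 0 s' = 0.
  have := mDl U (fun=> 1) 0 0 s' oU (regfun_cst 1 oU).
  by rewrite !act1// addr0 => /esym /eqP; rewrite -subr_eq0 addrK => /eqP.
have m0r s' : m U s' 0 = 0.
  have := mDr U (fun=> 1) s' 0 0 oU (regfun_cst 1 oU).
  by rewrite !act1// addr0 => /esym /eqP; rewrite -subr_eq0 addrK => /eqP.
have -> : m U (act U f s) (act U g t) = act U f (m U s (act U g t)).
  by have := mDl U f s 0 (act U g t) oU rf; rewrite addr0 m0l addr0.
have -> : m U s (act U g t) = act U g (m U s t).
  by have := mDr U g s t 0 oU rg; rewrite addr0 m0r addr0.
by rewrite actM.
Qed.

Lemma sheaf_hom0 A B (h : forall U, sec A U -> sec B U) U :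
  sheaf_hom h -> open U -> h U 0 = 0.
Proof.
move=> [hlin _] oU; apply: addrr_eq0.
by have := hlin U (fun=> 1) 0 0 oU (regfun_cst 1 oU); rewrite !act1// addr0.
Qed.

(** Seen as a map from E to j_* (E|_U), restriction is one of the two homomorphisms compared by the
    uniqueness clause in [tensor_frame1]. *)
Lemma open_pushforward_res_hom U E (oU : open U) :
  sheaf_hom (B := open_pushforward oU E) (fun V (s : sec E V) => res (U `&` V) s).
Proof.
split=> [V f s t oV rf|V W s oV oW WV].
  by have := @res_lin _ _ E V (U `&` V) f s t oV (openI oU oV) (@subIsetr _ _ _) rf.
rewrite /= !res_comp//; do ?[exact: openI|exact: setIS].
Qed.

(* The universal property is applied to j_* (A|_U) and j_* (P|_U), where j is
   the inclusion of U: the bilinear map (s, t) |-> fcoef t . s shows that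
   tau (a, b) is free, and the uniqueness that it generates P|_U. *)
Lemma tensor_frame1 A B P (tau : forall U, sec A U -> sec B U -> sec P U)
    U (a : sec A U) (b : sec B U) :
  sheaf_bilinear tau ->
  (forall Q (m : forall U, sec A U -> sec B U -> sec Q U), sheaf_bilinear m ->
  (exists2 h : forall U, sec P U -> sec Q U, sheaf_hom h &
     forall U s t, open U -> h U (tau U s t) = m U s t) /\
  (forall h h' : forall U, sec P U -> sec Q U, sheaf_hom h -> sheaf_hom h' ->
     (forall U s t, open U -> h U (tau U s t) = h' U (tau U s t)) ->
     forall U s, open U -> h U s = h' U s)) ->
  frame1 a -> frame1 b -> frame1 (tau U a b).
Proof.
move=> bil univ fa fb; have oU := frame1_open fa.
have [tDl tDr tres] := bil.
have oI V : open V -> open (U `&` V) by exact: openI.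
(* The universal property asks for maps over every open V, while coordinates along b exist only
   inside U; hence the restriction to the intersection, which j_* absorbs. *)
pose cb V (t : sec B V) := fcoef b (res (U `&` V) t).
have cbreg V (t : sec B V) : open V -> regfun X (U `&` V) (cb V t).
  by move=> oV; apply: fcoef_regfun => //; exact: oI.
have cblin V f (t t' : sec B V) x : open V -> regfun X V f -> (U `&` V) x ->
    cb V (act V f t + t') x = f x * cb V t x + cb V t' x.
  move=> oV rf Ix; rewrite /cb res_lin//; last exact: oI.
  apply: fcoef_lin => //; first exact: oI.
  by apply: regfun_sub rf => //; exact: oI.
have cbres V W (t : sec B V) x : open V -> open W -> W `<=` V ->
    (U `&` W) x -> cb W (res W t) x = cb V t x.
  move=> oV oW WV Ix; rewrite /cb res_comp//; last exact: oI.
  rewrite -(@res_comp _ _ B V (U `&` V)) //; do ?[exact: oI|exact: setIS].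
  by apply: fcoef_res => //; do ?[exact: oI|exact: setIS].
pose QA := open_pushforward oU A; pose QP := open_pushforward oU P.
pose m V (s : sec A V) (t : sec B V) : sec QA V :=
  act (U `&` V) (cb V t) (res (U `&` V) s).
have mbil : sheaf_bilinear m.
  split=> [V f s s' t oV rf|V f s t t' oV rf|V W s t oV oW WV].
  - have rfI : regfun X (U `&` V) f by apply: regfun_sub rf => //; exact: oI.
    have rc := cbreg V t oV; have oUV := oI _ oV.
    rewrite /m res_lin// actDr// -actM//; congr (_ + _).
    rewrite /= -actM//.
    by apply: eq_act => // x _; rewrite mulrC.
  - have rfI : regfun X (U `&` V) f by apply: regfun_sub rf => //; exact: oI.
    have rc := cbreg V t oV; have rc' := cbreg V t' oV; have oUV := oI _ oV.
    have rfc := regfun_mul oUV rfI rc.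
    rewrite /m /= -actM// -actDl//.
    by apply: eq_act => // x Ix; exact: cblin.
  - have [oUV oUW] := (oI _ oV, oI _ oW).
    have WVI : U `&` W `<=` U `&` V by exact: setIS.
    rewrite /m /= res_act//; last exact: cbreg.
    rewrite !res_comp//.
    by apply: eq_act => // x Ix; exact: cbres.
have [[h hhom htau] _] := univ QA m mbil.
have [hlin hres] := hhom.
pose cp V (s : sec P V) := fcoef a (h V s).
have UI V : V `<=` U -> U `&` V = V by move=> VU; apply/setIidPr.
have tabres V : open V -> V `<=` U ->
    res V (tau U a b) = tau V (res V a) (res V b) by move=> oV VU; rewrite tres.
have htab V f : open V -> V `<=` U -> regfun X V f ->
    h V (act V f (res V (tau U a b))) = act (U `&` V) f (res (U `&` V) a).
  move=> oV VU rf.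
  have := hlin V f (res V (tau U a b)) 0 oV rf.
  have oUV := oI _ oV.
  rewrite (sheaf_hom0 hhom)// !addr0 => ->; rewrite tabres// htau//= /m.
  have rf' : regfun X (U `&` V) f by rewrite UI.
  have c1 x : (U `&` V) x -> cb V (res V b) x = 1.
    move=> Ix; rewrite /cb res_comp//.
    by apply: fcoef_frame => //; exact: subIsetl.
  rewrite -actM//; last exact: cbreg.
  rewrite res_comp//.
  by apply: eq_act => // x Ix; rewrite c1// mulr1.
apply/frame1P; split=> // V oV VU; have oUV := oI _ oV; split; last first.
  move=> f rf f0.
  have := htab V f oV VU rf; rewrite f0 (sheaf_hom0 hhom)//.
  move=> /esym fa0 x Vx.
  have [_ /(_ _ oUV (@subIsetl _ _ _))[_ indep]] := (frame1P a).1 fa.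
  by apply: (indep f) => //; rewrite UI.
move=> s.
have cpreg W (s' : sec P W) : open W -> regfun X (U `&` W) (cp W s').
  by move=> oW; apply: fcoef_regfun => //; exact: oI.
(* This agrees with the restriction to U on all tau (s, t), so by uniqueness it agrees everywhere: a
   section over V inside U is the multiple of tau (a, b) by [cp]. *)
pose h' W (s' : sec P W) : sec QP W :=
  act (U `&` W) (cp W s') (res (U `&` W) (tau U a b)).
have h'hom : sheaf_hom h'.
  split=> [W f s1 s2 oW rf|W W' s1 oW oW' W'W].
    have oUW := oI _ oW.
    have rfI : regfun X (U `&` W) f by exact: regfun_sub rf.
    have [rc1 rc2] := (cpreg W s1 oW, cpreg W s2 oW).
    have rfc := regfun_mul oUW rfI rc1.
    rewrite /h' /= -actM// -actDl//; apply: eq_act => // x Ix.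
    rewrite /cp hlin//.
    apply: (@fcoef_lin _ _ A U a fa (U `&` W)) => //.
  have [oUW oUW'] := (oI _ oW, oI _ oW').
  have WWI : U `&` W' `<=` U `&` W by exact: setIS.
  rewrite /h' /= res_act//; last exact: cpreg.
  rewrite res_comp//.
  apply: eq_act => // x Ix; rewrite /cp hres//.
  by apply: (@fcoef_res _ _ A U a fa (U `&` W)).
(* The uniqueness clause of is_tensor comes with a bilinear map, any of which
   will do. *)
pose zmap V (s : sec A V) (t : sec B V) : sec QP V := 0.
have zbil : sheaf_bilinear zmap.
  split=> [W f ? ? ? oW rf|W f ? ? ? oW rf|W W' ? ? oW oW' WW]; rewrite /zmap.
  - by rewrite act_r0 ?addr0.
  - by rewrite act_r0 ?addr0.
  - by rewrite res_0.
have [_ uniq] := univ QP zmap zbil.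
have := uniq _ _ (open_pushforward_res_hom P oU) h'hom _ V s oV.
have tauE W (s' : sec A W) (t : sec B W) : open W ->
    res (U `&` W) (tau W s' t) = h' W (tau W s' t).
  move=> oW; have oUW := oI _ oW.
  rewrite /h' -tres// -{1}(fcoefE fa (res (U `&` W) s') oUW (@subIsetl _ _ _)).
  rewrite -{1}(fcoefE fb (res (U `&` W) t) oUW (@subIsetl _ _ _)).
  have ra := fcoef_regfun fa (res (U `&` W) s') oUW (@subIsetl _ _ _).
  have rb := fcoef_regfun fb (res (U `&` W) t) oUW (@subIsetl _ _ _).
  rewrite (sheaf_bilinear_act _ _ bil)// tres//.
  apply: eq_act => // x Ix; rewrite /cp htau// /m.
  have := fcoef_lin fa (f := cb W t) (res (U `&` W) s') 0 oUW
    (@subIsetl _ _ _) (cbreg _ _ oW) Ix.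
  rewrite addr0 => ->.
  have -> : fcoef a (0 : sec A (U `&` W)) x = 0.
    apply: (fcoef_unique fa (f := fun=> 0)) Ix => //; first exact: regfun_cst.
    by rewrite act_l0.
  by rewrite addr0 mulrC.
move=> /(_ tauE) /= sE.
exists (cp V s); first by rewrite -{1}(UI _ VU); exact: cpreg.
move: sE; rewrite /h'; move: (cp V s); rewrite UI//.
by rewrite res_id.
Qed.

End Tensor.

Section Dual.
Variables (k : closedFieldType) (X : fun_space k).
Implicit Types (E : modsheaf X) (U V W : set X) (f g : X -> k).

Lemma functional_act E U (l : forall V, sec E V -> X -> k) V f (s : sec E V) :
  functional U l -> open V -> V `<=` U -> regfun X V f ->
  forall x, V x -> l V (act V f s) x = f x * l V s x.
Proof.
move=> [_ llin _] oV VU rf x Vx.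
have l0 : l V 0 x = 0.
  have := llin V (fun=> 1) 0 0 oV VU (regfun_cst 1 oV) x.
  rewrite inE => /(_ Vx); rewrite act1// addr0 mul1r.
  by move=> /esym /addrr_eq0.
have := llin V f s 0 oV VU rf x; rewrite inE => /(_ Vx).
by rewrite addr0 l0 addr0.
Qed.

(** The functional [fcoef a] is represented by some d, whose value on a is 1. Any d' is the multiple
    of d by the value of d' on a, because both have the same values on all multiples of a and the
    uniqueness half of duality applies. *)
Lemma dual_frame1 A D (p : forall U, sec D U -> sec A U -> X -> k) U
    (a : sec A U) :
  pairing p ->
  (forall U, open U ->
   (forall l : forall V, sec A V -> X -> k, functional U l ->
     exists d : sec D U, forall V s, open V -> V `<=` U ->
       {in V, p V (res V d) s =1 l V s}) /\
   (forall d : sec D U, (forall V s, open V -> V `<=` U ->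
       {in V, p V (res V d) s =1 fun=> 0}) -> d = 0)) ->
  frame1 a -> exists2 d : sec D U, frame1 d & forall x, U x -> p U d a x = 1.
Proof.
move=> [pl pr] univ fa; have oU := frame1_open fa.
have fl : functional U (fun V (s : sec A V) => fcoef a s).
  split=> [V s oV VU|V f s t oV VU rf x|V W s oV oW VU WV x].
  - exact: fcoef_regfun.
  - by rewrite inE => Vx; exact: fcoef_lin.
  - by rewrite inE => Vx; exact: fcoef_res.
have [d dE] := (univ U oU).1 _ fl.
have pdE V (s : sec A V) x : open V -> V `<=` U -> V x ->
    p V (res V d) s x = fcoef a s x.
  by move=> oV VU Vx; apply: dE; rewrite ?inE.
exists d; last first.
  move=> x Ux; rewrite -[d]res_id// pdE//.
  by have := fcoef_frame fa oU (@subset_refl _ U) Ux; rewrite res_id.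
have pact V (f : X -> k) (d' : sec D V) (s : sec A V) x :
    open V -> regfun X V f -> V x -> p V (act V f d') s x = f x * p V d' s x.
  move=> oV rf Vx.
  have := functional_act d' (pr V s oV) oV (@subset_refl _ V) rf Vx.
  by rewrite !res_id.
apply/frame1P; split=> // V oV VU; split=> [d'|f rf f0 x Vx]; last first.
  have rd := fcoef_frame fa oV VU Vx.
  have := pact V f (res V d) (res V a) x oV rf Vx.
  rewrite pdE// rd mulr1 => <-; rewrite f0.
  have := pact V (fun=> 0) 0 (res V a) x oV (regfun_cst 0 oV) Vx.
  by rewrite mul0r act_l0.
have [preg plin pres] := pl V d' oV.
have rpa : regfun X V (p V d' (res V a)).
  by have := preg V (res V a) oV (@subset_refl _ V); rewrite res_id.
exists (p V d' (res V a)) => //.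
apply/eqP; rewrite -subr_eq0; apply/eqP; apply: (univ V oV).2 => W s oW WV x.
rewrite inE => Wx; have WU := subset_trans WV VU.
have rpW := regfun_sub oV oW WV rpa.
have := rpW => /(regfun_opp oW) rpN.
have -> : res W (d' - act V (p V d' (res V a)) (res V d)) =
    act W (fun x => - p V d' (res V a) x) (res W d) + res W d'.
  rewrite act_N// addrC res_D//; congr (_ + _).
  have rV := regfun_opp oV rpa.
  by rewrite -act_N// res_act// res_comp// act_N.
have [_ prlin _] := pr W s oW.
have := prlin W _ (res W d) (res W d') oW (@subset_refl _ W) rpN x.
rewrite inE !res_id// => -> //; rewrite pdE//.
have ps : p W (res W d') s x = fcoef a s x * p V d' (res V a) x.
  rewrite -{1}(fcoefE fa s oW WU).
  rewrite (functional_act (l := fun W s => p W (res W d') s) _ (pl V d' oV))//.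
    congr (_ * _); rewrite -(res_comp a oU oV oW VU WV).
    by rewrite pres ?inE// res_id.
  exact: fcoef_regfun.
by rewrite ps mulNr mulrC addNr.
Qed.

End Dual.

(** * Transition functions of line bundles, their duals and monomials *)

Section LineBundleTransitions.
Variables (k : closedFieldType) (X : fun_space k) (I : Type) (W : I -> set X).
Implicit Types (E A B D P : modsheaf X) (u v : I -> I -> X -> k).

(** The rank one case of [transition_by] with functions in place of matrices. Invertibility is left
    out because it follows, see [transition1_inv]. *)
Definition transition1 E (e : forall i, sec E (W i)) u : Prop :=
  (forall i, frame1 (e i)) /\
  forall i j, regfun X (W i `&` W j) (u i j) /\
    res (W i `&` W j) (e j) =
      act (W i `&` W j) (u i j) (res (W i `&` W j) (e i)).

Definition has_transition1 E u : Prop := exists e, @transition1 E e u.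

Lemma transition1_inv E (e : forall i, sec E (W i)) u : transition1 e u ->
  forall i j x, (W i `&` W j) x -> u i j x * u j i x = 1.
Proof.
move=> [fe ue] i j x Wx; have [oi oj] := (frame1_open (fe i), frame1_open (fe j)).
have oI := openI oi oj.
have [ruij eij] := ue i j; have [] := ue j i; rewrite setIC => ruji eji.
have := regfun_mul oI ruij ruji => rm.
apply: (frame1_inj (fe j) oI (@subIsetr _ _ _) rm (regfun_cst 1 oI)) Wx.
by rewrite act1// {2}eij eji -actM//; apply: eq_act => // y _; rewrite mulrC.
Qed.

Lemma has_transition1_unit E u i j : has_transition1 E u ->
  open (W i `&` W j) /\ unit_on (W i `&` W j) (u i j).
Proof.
move=> [e te]; have [fe ue] := te.
split; first exact: openI (frame1_open (fe i)) (frame1_open (fe j)).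
split; first by have [] := ue i j.
have [] := ue j i; rewrite setIC => ruji _; exists (u j i) => // x.
by rewrite inE => Wx; exact: transition1_inv te _ _ _ _.
Qed.

Lemma eq_has_transition1 E u v :
  (forall i j x, (W i `&` W j) x -> u i j x = v i j x) ->
  has_transition1 E u -> has_transition1 E v.
Proof.
move=> uv [e [fe ue]]; exists e; split=> // i j; have [ru eij] := ue i j.
have oI := openI (frame1_open (fe i)) (frame1_open (fe j)).
split; first by apply: eq_regfun ru => // x; exact: uv.
by rewrite eij; apply: eq_act => // x; exact: uv.
Qed.

Lemma structure_sheaf_transition1 P : (forall i, open (W i)) ->
  is_structure_sheaf P -> has_transition1 P (fun _ _ _ => 1).
Proof.
move=> oW [e fe]; exists (fun i => res (W i) e); split=> [i|i j].
  exact: frame1_res.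
have oI := openI (oW i) (oW j); split; first exact: regfun_cst.
by rewrite act1// !res_comp//; exact: openT.
Qed.

Lemma tensor_transition1 A B P u v : is_tensor A B P ->
  has_transition1 A u -> has_transition1 B v ->
  has_transition1 P (fun i j x => u i j x * v i j x).
Proof.
move=> [t bil univ] [a [fa ua]] [b [fb vb]].
exists (fun i => t (W i) (a i) (b i)); split=> [i|i j].
  exact: (tensor_frame1 bil univ).
have [[ru ea] [rv eb]] := (ua i j, vb i j).
have [oi oj] := (frame1_open (fa i), frame1_open (fa j)); have oI := openI oi oj.
split; first exact: regfun_mul.
have [_ _ tres] := bil.
rewrite -tres//.
by rewrite -tres// ea eb (sheaf_bilinear_act _ _ bil).
Qed.

(** Let d_i take the value 1 on a_i, and d_j = c d_i. Evaluating on a_j gives 1 = c d_i(a_j), and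
    a_i = u_ji a_j gives 1 = u_ji d_i(a_j); hence c = u_ji. *)
Lemma dual_transition1 A D u : is_dual A D -> has_transition1 A u ->
  has_transition1 D (fun i j => u j i).
Proof.
move=> [p pp univ] [a [fa ua]].
have ex i := dual_frame1 pp univ (fa i).
have oW i := frame1_open (fa i).
pose d i := s2val (cid2 (ex i)).
have fd i : frame1 (d i) by exact: s2valP.
have pd i x : W i x -> p (W i) (d i) (a i) x = 1.
  move: x; exact: (s2valP' (cid2 (ex i))).
exists d; split=> // i j; have oI := openI (oW i) (oW j).
have [] := ua j i; rewrite setIC => ruji eji; split=> //.
have [plin prlin] := pp.
have pres V V' (d' : sec D V) (s : sec A V) x : open V -> open V' -> V' `<=` V ->
    V' x -> p V' (res V' d') (res V' s) x = p V d' s x.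
  move=> oV oV' V'V V'x; have [_ _ pr] := plin V d' oV.
  by rewrite pr ?inE// res_id.
have [rc eC] := fcoefP (fd i) (res (W i `&` W j) (d j)) oI (@subIsetl _ _ _).
rewrite eC; apply: eq_act => // x Wx; move: (Wx) => [Wix Wjx].
set c := fcoef _ _ in rc eC *.
have := pres _ _ (d j) (a j) x (oW j) oI (@subIsetr _ _ _) Wx.
rewrite pd// eC => p1.
have pact (f : X -> k) d' (s : sec A (W i `&` W j)) : regfun X (W i `&` W j) f ->
    p _ (act (W i `&` W j) f d') s x = f x * p _ d' s x.
  move=> rf; have := functional_act d' (prlin _ s oI) oI (@subset_refl _ _) rf Wx.
  by rewrite !res_id.
have pact' (f : X -> k) d' (s : sec A (W i `&` W j)) : regfun X (W i `&` W j) f ->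
    p _ d' (act (W i `&` W j) f s) x = f x * p _ d' s x.
  move=> rf; have := functional_act s (plin _ d' oI) oI (@subset_refl _ _) rf Wx.
  by rewrite !res_id.
have := pres _ _ (d i) (a i) x (oW i) oI (@subIsetl _ _ _) Wx.
rewrite pd// eji pact'// => p2.
by rewrite -[LHS]mulr1 -p2 mulrCA -pact// p1 mulr1.
Qed.

(** The frames become c_i e_i. The case c_i = a_i1, for the dual bundle, accounts for the shape of
    K^-. *)
Lemma rescale_transition1 E u (c : I -> X -> k) : has_transition1 E u ->
  (forall i, unit_on (W i) (c i)) ->
  has_transition1 E (fun i j x => u i j x * c j x / c i x).
Proof.
move=> [e [fe ue]] uc; exists (fun i => act (W i) (c i) (e i)).
have oW i := frame1_open (fe i).
split=> [i|i j].
  by rewrite -[e i]res_id//; exact: frame1_unit.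
have [ru eij] := ue i j; have oI := openI (oW i) (oW j).
have [rci _] := uc i; have [rcj _] := uc j.
have rciI := regfun_sub (oW i) oI (@subIsetl _ _ _) rci.
have rcjI := regfun_sub (oW j) oI (@subIsetr _ _ _) rcj.
have rii := regfun_sub (oW i) oI (@subIsetl _ _ _) (unit_on_inv (oW i) (uc i)).
have ruc := regfun_mul oI ru rcjI.
have rt := regfun_mul oI ruc rii.
split=> //.
rewrite !res_act//.
rewrite eij -!actM//; apply: eq_act => // x [Wi Wj].
by rewrite divfK ?(unit_on_neq0 (uc i))// mulrC.
Qed.

Lemma tensor_power_transition1 A u n P : (forall i, open (W i)) ->
  has_transition1 A u -> is_tensor_power A n P ->
  has_transition1 P (fun i j x => u i j x ^+ n).
Proof.
move=> oW tA; elim: n P => [|n IHn] P /=.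
  by move=> /(structure_sheaf_transition1 oW); apply: eq_has_transition1.
move=> [Q /IHn tQ /tensor_transition1 /(_ tQ tA)].
by apply: eq_has_transition1 => i j x _; rewrite exprSr.
Qed.

Lemma monomial_transition1 m (L : 'I_m -> modsheaf X) (n : 'I_m -> int)
    (up um : 'I_m -> I -> I -> X -> k) P : (forall i, open (W i)) ->
  (forall r, has_transition1 (L r) (up r)) ->
  (forall r D, is_dual (L r) D -> has_transition1 D (um r)) ->
  is_monomial L n P ->
  has_transition1 P (fun i j x =>
    \prod_(r < m) (if 0 <= n r then up r i j x else um r i j x) ^+ `|n r|%N).
Proof.
move=> oW tp tm.
(* [is_power_product] recurses on a list, so the induction is on an arbitrary list of indices
   instead of the full enumeration. *)
suff prod_seq (s : seq 'I_m) Q : is_power_product [seq (L i, n i) | i <- s] Q ->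
    has_transition1 Q (fun i j x =>
      \prod_(r <- s) (if 0 <= n r then up r i j x else um r i j x) ^+ `|n r|%N).
  move=> /prod_seq; apply: eq_has_transition1 => i j x _.
  by rewrite big_enum.
elim: s Q => [|r s IHs] Q /=.
  move=> /(structure_sheaf_transition1 oW); apply: eq_has_transition1 => i j x _.
  by rewrite big_nil.
move=> [A [Q' [pA /IHs tQ' /tensor_transition1 tens]]].
have tA : has_transition1 A (fun i j x =>
    (if 0 <= n r then up r i j x else um r i j x) ^+ `|n r|%N).
  case: (n r) pA => q /=; first exact: (tensor_power_transition1 oW (tp r)).
  (* [Negz q] is -(q + 1): the exponent on the dual is q + 1, the absolute value of n r. *)
  move=> [D /tm tD pD].
  exact: (@tensor_power_transition1 D (um r) q.+1 A oW tD pD).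
apply: eq_has_transition1 (tens _ _ tA tQ') => i j x _.
by rewrite big_cons.
Qed.

End LineBundleTransitions.

(** * Two-by-two matrices with regular entries *)

Section Matrices.
Variables (k : closedFieldType) (X : fun_space k).
Implicit Types (U V : set X) (f g : X -> k).

Lemma mx2E (a b c d : k) : mx2 a b c d =
  \matrix_(i, j) (if i == 0 then if j == 0 then a else b
                  else if j == 0 then c else d).
Proof.
apply/matrixP => i j; rewrite !mxE.
by case: i => [[|[|i]] Hi]; case: j => [[|[|j]] Hj].
Qed.

Lemma ord2P (i : 'I_2) : i = 0 \/ i = 1.
Proof. by case: i => [[|[|i]] Hi] //; [left|right]; apply: val_inj. Qed.

Lemma mx2_ext (A B : 'M[k]_2) : A 0 0 = B 0 0 -> A 0 1 = B 0 1 ->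
  A 1 0 = B 1 0 -> A 1 1 = B 1 1 -> A = B.
Proof.
move=> e00 e01 e10 e11; apply/matrixP => i j.
by case: (ord2P i) => ->; case: (ord2P j) => ->.
Qed.

Lemma mulmx2E (A B : 'M[k]_2) i j : (A *m B) i j = A i 0 * B 0 j + A i 1 * B 1 j.
Proof.
rewrite mxE !big_ord_recl big_ord0 addr0.
by rewrite (_ : lift ord0 ord0 = 1)//; apply: val_inj.
Qed.

Lemma det_mx2 (A : 'M[k]_2) : \det A = A 0 0 * A 1 1 - A 0 1 * A 1 0.
Proof.
have l1 (i : 'I_1) : lift 0 i = 1 :> 'I_2 by rewrite (ord1 i); exact: val_inj.
have l0 (i : 'I_1) : lift 1 i = 0 :> 'I_2 by rewrite (ord1 i); exact: val_inj.
rewrite (expand_det_row _ 0) !big_ord_recl big_ord0 addr0 /cofactor !det_mx11.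
by rewrite !mxE /= !l1 l0 expr0 expr1 mul1r mulN1r mulrN.
Qed.

Lemma GL_on_mul r U (K K' : X -> 'M[k]_r) : open U -> GL_on U K -> GL_on U K' ->
  GL_on U (fun x => K x *m K' x).
Proof.
move=> oU [rK [L rL KL]] [rK' [L' rL' KL']].
have reg (A B : X -> 'M[k]_r) : (forall a b, regfun X U (fun x => A x a b)) ->
    (forall a b, regfun X U (fun x => B x a b)) ->
    forall a b, regfun X U (fun x => (A x *m B x) a b).
  move=> rA rB a b.
  apply: (@eq_regfun _ _ _ (fun x => \sum_c (A x a c * B x c b))) => //.
    by move=> x _; rewrite mxE.
  elim: (index_enum _) => [|c s IHs].
    apply: (@eq_regfun _ _ _ (fun=> 0)) => //; last exact: regfun_cst.
    by move=> x _; rewrite big_nil.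
  apply: (@eq_regfun _ _ _ (fun x =>
    A x a c * B x c b + \sum_(d <- s) (A x a d * B x d b))) => //.
    by move=> x _; rewrite big_cons.
  by apply: regfun_add => //; exact: (regfun_mul oU (rA a c) (rB c b)).
split; first exact: reg.
exists (fun x => L' x *m L x); first exact: reg.
by move=> x Ux; rewrite -mulmxA (mulmxA (K' x)) KL'// mul1mx KL.
Qed.

Lemma GL_on_diag U f : open U -> unit_on U f -> GL_on U (fun x => mx2 1 0 0 (f x)).
Proof.
move=> oU uf; have ri := unit_on_inv oU uf; have [rf _] := uf.
have reg g : regfun X U g -> forall a b, regfun X U (fun x => mx2 1 0 0 (g x) a b).
  move=> rg a b; apply: (@eq_regfun _ _ _ (fun x =>
      if a == 0 then if b == 0 then 1 else 0 else if b == 0 then 0 else g x)) => //.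
    by move=> x _; rewrite mx2E mxE.
  by case: (a == 0); case: (b == 0) => //; exact: regfun_cst.
split; first exact: reg; exists (fun x => mx2 1 0 0 (f x)^-1); first exact: reg.
move=> x; rewrite inE => Ux; have fn0 := unit_on_neq0 uf Ux.
by apply: mx2_ext;
  rewrite mulmx2E !mx2E !mxE/= ?mulr1 ?mulr0 ?mul0r ?addr0 ?add0r ?divff.
Qed.

Lemma GL1_unit_on U f : open U -> GL_on U (fun x => (f x)%:M : 'M_1) -> unit_on U f.
Proof.
move=> oU [rf [L rL fL]]; split.
  apply: eq_regfun (rf 0 0) => // x _; by rewrite mxE eqxx.
exists (fun x => L x 0 0) => [|x Ux]; first exact: rL.
have := fL x Ux => /matrixP /(_ 0 0).
by rewrite mul_scalar_mx !mxE.
Qed.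

Lemma det_unit_on U (K : X -> 'M[k]_2) : open U -> GL_on U K ->
  unit_on U (fun x => \det (K x)).
Proof.
move=> oU [rK [L rL KL]].
have reg (A : X -> 'M[k]_2) : (forall a b, regfun X U (fun x => A x a b)) ->
    regfun X U (fun x => \det (A x)).
  move=> rA; apply: (@eq_regfun _ _ _ (fun x =>
    A x 0 0 * A x 1 1 + - (A x 0 1 * A x 1 0))) => //.
    by move=> x _; rewrite det_mx2.
  by apply: regfun_add => //; [|apply: regfun_opp => //];
    exact: regfun_mul (rA _ _) (rA _ _).
split; first exact: reg; exists (fun x => \det (L x)); first exact: reg.
by move=> x Ux; rewrite -det_mulmx KL// det1.
Qed.

End Matrices.

(** * The algebra O + O t and the matrices of its multiplications *)

Section MultiplicationByT.
Variables (k : closedFieldType) (X Y : fun_space k) (phi : morphism X Y).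
Variables (N : modsheaf Y) (D : double_cover_structure phi N).

Lemma open_preimage V : open V -> open (phi @^-1` V).
Proof. by move=> oV; apply: open_comp => // x _; exact: morph_continuous. Qed.

Lemma tau0 (V : set Y) x : open V -> V (phi x) -> tau D (0 : sec N V) x = 0.
Proof.
move=> oV Vx.
have := @tau_lin _ _ _ _ _ D V (fun=> 1) 0 0 oV (regfun_cst 1 oV) x.
rewrite inE => /(_ Vx); rewrite act1// addr0 mul1r.
by move=> /esym /addrr_eq0.
Qed.

Lemma tau_linear (V : set Y) f (nu nu' : sec N V) x :
  open V -> regfun Y V f -> V (phi x) ->
  tau D (act V f nu + nu') x = f (phi x) * tau D nu x + tau D nu' x.
Proof. by move=> oV rf Vx; apply: tau_lin => //; rewrite inE. Qed.

Lemma tauD (V : set Y) (nu nu' : sec N V) x : open V -> V (phi x) ->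
  tau D (nu + nu') x = tau D nu x + tau D nu' x.
Proof.
move=> oV Vx; have := tau_linear nu nu' oV (regfun_cst 1 oV) Vx.
by rewrite act1// mul1r.
Qed.

Lemma tauZ (V : set Y) f (nu : sec N V) x : open V -> regfun Y V f ->
  V (phi x) -> tau D (act V f nu) x = f (phi x) * tau D nu x.
Proof.
move=> oV rf Vx; have := tau_linear nu 0 oV rf Vx.
by rewrite addr0 tau0// addr0.
Qed.

Lemma tauM (V : set Y) (nu nu' : sec N V) x : open V -> V (phi x) ->
  tau D nu x * tau D nu' x = branch_eq D nu nu' (phi x).
Proof. by move=> oV Vx; apply: tau_mul => //; rewrite inE. Qed.

Lemma branch_eq_reg (V : set Y) (nu nu' : sec N V) : open V ->
  regfun Y V (branch_eq D nu nu').
Proof.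
move=> oV; have [p1 _] := branch_eq_pairing D.
have [preg _ _] := p1 V nu oV.
by have := preg V nu' oV (@subset_refl _ V); rewrite res_id.
Qed.

Section OneFrame.
Variables (U : set Y) (nu : sec N U).
Hypothesis fnu : frame1 nu.
Let t := tau D nu.
Let F := branch_eq D nu nu.
Let oU := frame1_open fnu.

Lemma tau_sqr x : (phi @^-1` U) x -> t x * t x = F (phi x).
Proof. by move=> Ux; exact: tauM. Qed.

Lemma branch_eq_regfun V : open V -> V `<=` U -> regfun Y V F.
Proof.
by move=> oV VU; apply: (@regfun_sub _ _ U) => //; exact: branch_eq_reg.
Qed.

Lemma tau_regfun_sub V : open V -> V `<=` U -> regfun X (phi @^-1` V) t.
Proof.
move=> oV VU; apply: (@regfun_sub _ _ (phi @^-1` U)).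
- exact: open_preimage.
- exact: open_preimage.
- by move=> x /VU.
- exact: tau_regfun.
Qed.

Lemma tau_act V f x : open V -> V `<=` U -> regfun Y V f -> V (phi x) ->
  tau D (act V f (res V nu)) x = f (phi x) * t x.
Proof.
move=> oV VU rf Vx.
by rewrite tauZ// (tau_res D nu oU oV VU)// inE.
Qed.

Lemma frame_split V f : open V -> V `<=` U -> regfun X (phi @^-1` V) f ->
  exists p q, [/\ regfun Y V p, regfun Y V q
    & forall x, V (phi x) -> f x = p (phi x) + q (phi x) * t x].
Proof.
move=> oV VU rf; have [p [nu' [rp fE]]] := tau_split D oV rf.
have [rq eq] := fcoefP fnu nu' oV VU.
exists p, (fcoef nu nu'); split=> // x Vx.
by rewrite fE ?inE// {1}eq tau_act.
Qed.

Lemma frame_direct V p q : open V -> V `<=` U -> regfun Y V p -> regfun Y V q ->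
  (forall x, V (phi x) -> p (phi x) + q (phi x) * t x = 0) ->
  forall y, V y -> p y = 0 /\ q y = 0.
Proof.
move=> oV VU rp rq pq0 y Vy.
have [|p0 q0] := @tau_direct _ _ _ _ _ D V p (act V q (res V nu)) oV rp.
  by move=> x; rewrite inE => Vx; rewrite tau_act// pq0.
split; first by rewrite p0 ?inE.
have [_ /(_ V oV VU)[_ indep]] := (frame1P nu).1 fnu.
exact: indep.
Qed.

(* K is the matrix of the multiplication by u on O_V + O_V t. *)
Definition mul_matrix V (u : X -> k) (K : Y -> 'M[k]_2) : Prop :=
  exists p q, [/\ regfun Y V p, regfun Y V q,
    forall y, V y -> K y = (p y)%:M + q y *: mx2 0 (F y) 1 0
    & forall x, V (phi x) -> u x = p (phi x) + q (phi x) * t x].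

Lemma mul_matrix1 V : open V -> mul_matrix V (fun=> 1) (fun=> 1%:M).
Proof.
move=> oV; exists (fun=> 1), (fun=> 0).
split=> [||y _|x _]; try exact: regfun_cst.
  by rewrite scale0r addr0.
by rewrite mul0r addr0.
Qed.

(** The companion matrix [mx2 0 f 1 0] squares to f just as t squares to F, so sending p + q t to p
    E + q M^(0) is multiplicative. *)
Lemma scalar_add_scale_mul (p q p' q' f : k) :
  (p%:M + q *: mx2 0 f 1 0) *m (p'%:M + q' *: mx2 0 f 1 0) =
  (p * p' + q * q' * f)%:M + (p * q' + q * p') *: mx2 0 f 1 0.
Proof. by apply: mx2_ext; rewrite mulmx2E !mx2E !mxE/=; ring. Qed.

Lemma mul_matrixM V u K u' K' : open V -> V `<=` U ->
  mul_matrix V u K -> mul_matrix V u' K' ->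
  mul_matrix V (fun x => u x * u' x) (fun y => K y *m K' y).
Proof.
move=> oV VU [p [q [rp rq KE uE]]] [p' [q' [rp' rq' KE' uE']]].
have rF := branch_eq_regfun oV VU.
exists (fun y => p y * p' y + q y * q' y * F y), (fun y => p y * q' y + q y * p' y).
have rpp := regfun_mul oV rp rp'; have rqq := regfun_mul oV rq rq'.
have rqqF := regfun_mul oV rqq rF.
have rpq := regfun_mul oV rp rq'; have rqp := regfun_mul oV rq rp'.
split=> [||y Vy|x Vx]; try exact: regfun_add.
  by rewrite KE// KE'// scalar_add_scale_mul.
rewrite uE// uE'// -tau_sqr; last exact: VU.
ring.
Qed.

Lemma mul_matrixX V u K n : open V -> V `<=` U ->
  mul_matrix V u K -> mul_matrix V (fun x => u x ^+ n) (fun y => K y ^+ n).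
Proof.
move=> oV VU uK; elim: n => [|n IHn]; first exact: mul_matrix1.
have [p [q [rp rq KE uE]]] := mul_matrixM oV VU uK IHn.
by exists p, q; split=> // z Vz; rewrite exprS -?KE -?uE.
Qed.

Lemma mul_matrix_prod (J : Type) (s : seq J) V u K : open V -> V `<=` U ->
  (forall j, mul_matrix V (u j) (K j)) ->
  mul_matrix V (fun x => \prod_(j <- s) u j x) (fun y => \prod_(j <- s) K j y).
Proof.
move=> oV VU uK; elim: s => [|j s IHs].
  have [p [q [rp rq KE uE]]] := mul_matrix1 oV.
  by exists p, q; split=> // z Vz; rewrite big_nil -?KE -?uE.
have [p [q [rp rq KE uE]]] := mul_matrixM oV VU (uK j) IHs.
by exists p, q; split=> // z Vz; rewrite big_cons -?KE -?uE.
Qed.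

Lemma mul_matrix_regfun V u K a b : open V -> V `<=` U -> mul_matrix V u K ->
  regfun Y V (fun y => K y a b).
Proof.
move=> oV VU [p [q [rp rq KE _]]].
have rqF := regfun_mul oV rq (branch_eq_regfun oV VU).
apply: (@eq_regfun _ _ _ (fun y => if a == 0 then if b == 0 then p y else q y * F y
                  else if b == 0 then q y else p y)) => //.
  move=> y Vy; rewrite KE// mx2E !mxE.
  case: a => [[|[|a]] Ha]; case: b => [[|[|b]] Hb] //=; ring.
by case: (a == 0); case: (b == 0).
Qed.

(** The inverse of u is again of the form p' + q' t. The product of the two matrices belongs to the
    function 1, and since the coefficients of 1 and t are unique it is the identity. *)
Lemma mul_matrix_GL V u K : open V -> V `<=` U -> unit_on (phi @^-1` V) u ->
  mul_matrix V u K -> GL_on V K.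
Proof.
move=> oV VU [ru [u' ru' uu']] uK; split.
  by move=> a b; exact: mul_matrix_regfun uK.
have [p' [q' [rp' rq' uE']]] := frame_split oV VU ru'.
pose K' y := (p' y)%:M + q' y *: mx2 0 (F y) 1 0.
have uK' : mul_matrix V u' K' by exists p', q'.
exists K' => [a b|y]; first exact: mul_matrix_regfun uK'.
rewrite inE => Vy; have [p [q [rp rq -> // uE]]] := mul_matrixM oV VU uK uK'.
have rN1 := regfun_cst (-1) oV; have rp1 := regfun_add oV rp rN1.
have [|p1 ->] := frame_direct oV VU rp1 rq _ Vy.
  by move=> x Vx; rewrite addrAC -uE// uu' ?inE// subrr.
rewrite scale0r addr0; congr (_%:M); apply/eqP; rewrite -subr_eq0; apply/eqP.
exact: p1.
Qed.

Definition push_frame (E : modsheaf X) (w : sec E (phi @^-1` U)) (a : 'I_2) :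
  sec (pushforward phi E) U := if a == 0 then w else act (phi @^-1` U) t w.

(** A combination of w and t w is (f_0 + f_1 t) w. The coordinate along w and the splitting into
    multiples of 1 and t both exist and are unique, hence so are f_0 and f_1. *)
Lemma push_frameP E (w : sec E (phi @^-1` U)) :
  frame1 w -> frame (push_frame w).
Proof.
move=> fw; split=> // V oV VU.
have oU' := open_preimage oU; have oV' := open_preimage oV.
have VU' : phi @^-1` V `<=` phi @^-1` U by move=> x /VU.
have rt := tau_regfun_sub oV VU.
have rtU := tau_regfun_sub oU (@subset_refl _ U).
have sumE f : (forall a, regfun Y V (f a)) ->
    \sum_(a < 2) act (E := pushforward phi E) V (f a)
                   (res (E := pushforward phi E) V (push_frame w a)) =
    act (phi @^-1` V) (fun x => f 0 (phi x) + f 1 (phi x) * t x)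
      (res (phi @^-1` V) w).
  move=> rf; have [rf0 rf1] := (morph_regfun phi oV (rf 0), morph_regfun phi oV (rf 1)).
  rewrite !big_ord_recl big_ord0 addr0 (_ : lift ord0 ord0 = 1); last exact: val_inj.
  rewrite /push_frame /= res_act// -actM// -actDl//.
  exact: (regfun_mul oV' rf1 rt).
split=> [s|f rf].
  have [rc eC] := fcoefP fw s oV' VU'.
  have [p [q [rp rq cE]]] := frame_split oV VU rc.
  exists (fun a => if a == 0 then p else q); first by move=> a; case: (a == 0).
  rewrite sumE => [|a]; last by case: (a == 0).
  rewrite {1}eC; exact: (eq_act (res (phi @^-1` V) w) oV' cE).
rewrite sumE// => f0 a y; rewrite inE => Vy.
have [rf0 rf1] := (morph_regfun phi oV (rf 0), morph_regfun phi oV (rf 1)).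
have rft := regfun_add oV' rf0 (regfun_mul oV' rf1 rt).
have [_ /(_ _ oV' VU')[_ indep]] := (frame1P w).1 fw.
have [] := frame_direct oV VU (rf 0) (rf 1) (indep _ rft f0) Vy.
by case: (ord2P a) => ->.
Qed.

End OneFrame.

End MultiplicationByT.

(** Constants and variables generate the polynomial ring. Induction along ring operations suits
    properties of evaluation, such as multiplicativity or the form of a denominator. *)
Lemma mpoly_ring_ind n (k : comNzRingType) (P : mpoly n k -> Prop) :
  (forall a, P (mpolyC n a)) -> (forall i, P (mpolyX k (mnm1 i))) ->
  (forall p q, P p -> P q -> P (p + q)) ->
  (forall p q, P p -> P q -> P (p * q)) -> forall p, P p.
Proof.
move=> PC PX PD PM; have P1 : P 1 by rewrite -mpolyC1.
have PXn q d : P q -> P (q ^+ d).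
  by move=> Pq; elim: d => [|d IHd]; rewrite ?expr0// exprS; apply: (PM).
elim/mpolyind => [|a m p _ _ Pp]; first by rewrite -mpolyC0.
apply: PD => //; rewrite -mul_mpolyC; apply: (PM) => //.
rewrite mpolyXE_id; apply: (big_rec P) => [|i q _ Pq] //.
by apply: (PM) => //; exact: PXn.
Qed.

(** * Affine charts and their basic open subsets *)

Section AffineCharts.
Variables (k : closedFieldType) (X : fun_space k).
Implicit Types (U V W : set X) (f g : X -> k).

Definition basic_open U n (c : X -> 'I_n -> k) (p : mpoly n k) : set X :=
  U `&` [set x | meval (c x) p != 0].

(** The conditions under the existential quantifiers of [affine_open], stated for given coordinates
    so that these can be kept and changed. *)
Definition affine_chart U n (c : X -> 'I_n -> k) (S : set (mpoly n k)) : Prop :=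
  [/\ {in U &, injective c},
      c @` U = zero_locus S,
      forall V, V `<=` U ->
        (open V <-> forall x, V x -> exists p,
           basic_open U c p x /\ basic_open U c p `<=` V)
    & forall p f, regfun X (basic_open U c p) f <->
        exists q N, {in basic_open U c p, f =1 fun x =>
                     meval (c x) q / meval (c x) p ^+ N}].

Lemma affine_chart_ex U : affine_open U ->
  open U /\ exists n (c : X -> 'I_n -> k) S, affine_chart U c S.
Proof. by []. Qed.

Section Chart.
Variables (U : set X) (n : nat) (c : X -> 'I_n -> k) (S : set (mpoly n k)).
Hypothesis chart : affine_chart U c S.
Local Notation D := (basic_open U c).

Lemma open_basic p : open (D p).
Proof.
have [_ _ top _] := chart.
by apply: (top (D p) (@subIsetl _ _ _)).2 => x Dx; exists p; split.
Qed.

Lemma basic_openM p q : D (p * q) = D p `&` D q.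
Proof.
apply/seteqP; split=> x; rewrite /basic_open /= mevalM mulf_eq0 negb_or.
  by move=> [Ux /andP[]].
by move=> [[Ux p0] [_ q0]]; split=> //; apply/andP.
Qed.

Lemma basic_open1 : D 1 = U.
Proof.
apply/seteqP; split=> x; first by case.
by move=> Ux; split=> //=; rewrite meval1 oner_eq0.
Qed.

Lemma basic_open_sub V x : open V -> V `<=` U -> V x ->
  exists2 p, D p x & D p `<=` V.
Proof.
move=> oV VU Vx; have [_ _ top _] := chart.
by have [p [Dx DV]] := (top V VU).1 oV x Vx; exists p.
Qed.

Lemma chart_regfun p f : regfun X (D p) f <->
  exists q N, forall x, D p x -> f x = meval (c x) q / meval (c x) p ^+ N.
Proof.
have [_ _ _ reg] := chart; split.
  move=> /(reg p f).1 [q [N fE]]; exists q, N => x Dx.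
  by apply: fE; rewrite inE.
move=> [q [N fE]]; apply/(reg p f); exists q, N => x; rewrite inE; exact: fE.
Qed.

Lemma chart_regfun1 f : regfun X U f <->
  exists q, forall x, U x -> f x = meval (c x) q.
Proof.
rewrite -basic_open1; split.
  move=> /chart_regfun[q [N fE]]; exists q => x /fE ->.
  by rewrite meval1 expr1n divr1.
move=> [q fE]; apply/chart_regfun; exists q, 0%N => x /fE ->.
by rewrite expr0 divr1.
Qed.

Lemma regfun_coord i : regfun X U (fun x => c x i).
Proof. by apply/chart_regfun1; exists (mpolyX k (mnm1 i)) => x _; rewrite mevalXU. Qed.

Lemma chart_unit_near V f x : open V -> V `<=` U -> V x -> regfun X V f ->
  f x != 0 -> exists V', [/\ open V', V' x, V' `<=` V & unit_on V' f].
Proof.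
move=> oV VU Vx rf fx0; have [p Dx DV] := basic_open_sub oV VU Vx.
have := regfun_sub oV (open_basic p) DV rf.
move=> /chart_regfun[q [N fE]].
have sub : D (p * q) `<=` D p by rewrite basic_openM; exact: subIsetl.
exists (D (p * q)); split=> [|||].
- exact: open_basic.
- rewrite basic_openM; split=> //; split; first exact: VU.
  by move: fx0; rewrite fE//= mulf_eq0 negb_or => /andP[].
- exact: subset_trans DV.
split; first by apply: regfun_sub rf => //; [exact: open_basic|exact: subset_trans DV].
exists (fun y => meval (c y) p ^+ N / meval (c y) q).
  (* A fraction on D (p q) has a power of p q as denominator: p^N / q = p^(N+1) / (p q). *)
  apply/chart_regfun; exists (p ^+ N.+1), 1%N => y.
  rewrite basic_openM => -[[Uy /= py0] [_ /= qy0]].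
  by rewrite expr1 mevalM rmorphXn /= exprS; field; apply/andP.
move=> y; rewrite inE => Dy; rewrite fE; last exact: sub.
move: Dy; rewrite basic_openM => -[[Uy /= py0] [_ /= qy0]].
have pN : meval (c y) p ^+ N != 0 by rewrite expf_neq0.
by field; apply/andP.
Qed.

(* Rabinowitsch: D p is the closed subset X_0 p = 1 of U x k. *)
Let c' (p : mpoly n k) (x : X) (i : 'I_n.+1) : k :=
  if unlift ord0 i is Some j then c x j else (meval (c x) p)^-1.
Let incl (q : mpoly n k) : mpoly n.+1 k :=
  comp_mpoly [tuple mpolyX k (mnm1 (lift ord0 i)) | i < n] q.
Let X0 : mpoly n.+1 k := mpolyX k (mnm1 ord0).

Let meval_incl v q : meval v (incl q) = meval (fun i => v (lift ord0 i)) q.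
Proof.
rewrite /incl comp_mpoly_meval; apply: meval_eq => i.
by rewrite tnth_mktuple mevalXU.
Qed.

Let meval_c'_incl p x q : meval (c' p x) (incl q) = meval (c x) q.
Proof. by rewrite meval_incl; apply: meval_eq => i; rewrite /c' liftK. Qed.

Let meval_c'_X0 p x : meval (c' p x) X0 = (meval (c x) p)^-1.
Proof. by rewrite mevalXU /c' unlift_none. Qed.

(** The extra coordinate X_0 has the value 1 / p, so a polynomial in the new coordinates is a
    fraction over a power of p. *)
Let clear_denominators p (P : mpoly n.+1 k) : exists (q : mpoly n k) N,
  forall x, meval (c x) p != 0 ->
    meval (c' p x) P = meval (c x) q / meval (c x) p ^+ N.
Proof.
elim/mpoly_ring_ind: P =>
  [a|i|P1 P2 [q1 [N1 e1]] [q2 [N2 e2]]|P1 P2 [q1 [N1 e1]] [q2 [N2 e2]]].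
- by exists (mpolyC n a), 0%N => x _; rewrite !mevalC expr0 divr1.
- case: (unliftP ord0 i) => [j ->|->].
    exists (mpolyX k (mnm1 j)), 0%N => x _.
    by rewrite !mevalXU expr0 divr1 /c' liftK.
  by exists 1, 1%N => x _; rewrite meval_c'_X0 meval1 mul1r expr1.
- exists (q1 * p ^+ N2 + q2 * p ^+ N1), (N1 + N2)%N => x px0.
  rewrite !mevalD !mevalM e1// e2// !rmorphXn /= exprD.
  have p1 : meval (c x) p ^+ N1 != 0 by rewrite expf_neq0.
  have p2 : meval (c x) p ^+ N2 != 0 by rewrite expf_neq0.
  by field; apply/andP.
- exists (q1 * q2), (N1 + N2)%N => x px0.
  by rewrite !mevalM e1// e2// exprD invfM mulrACA.
Qed.

Lemma basic_open_affine p : affine_open (D p).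
Proof.
split; first exact: open_basic.
pose S' := [set P | (exists2 q, S q & P = incl q) \/ P = X0 * incl p - 1].
exists n.+1, (c' p), S' => D'.
have [inj img top reg] := chart.
(* If P = q / p^M on D p, then P and q vanish at the same points of D p: basic open sets for the new
   coordinates are basic open sets D (p q) for the old ones. *)
have D'E P : exists q, D' P = D (p * q) /\ exists N, forall x, D p x ->
    meval (c' p x) P = meval (c x) q / meval (c x) p ^+ N.
  have [q [N qE]] := clear_denominators p P; exists q.
  split; last by exists N => x [_ px0]; exact: qE.
  rewrite basic_openM; apply/seteqP; split=> x [Dx Px]; split=> //.
    split; first by case: Dx.
    have [_ px0] := Dx; move: Px.
    by rewrite /= qE// mulf_eq0 negb_or => /andP[].
  have [_ px0] := Dx; have [_ qx0] := Px.
  by rewrite /= qE// mulf_neq0// invr_neq0// expf_neq0.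
split.
- move=> x y; rewrite !inE => -[Ux _] [Uy _] cxy; apply: inj; rewrite ?inE//.
  apply/funext => i.
  have := congr1 (fun h : 'I_n.+1 -> k => h (lift ord0 i)) cxy.
  by rewrite /c' !liftK.
- apply/seteqP; split=> [_ [x [Ux /= px0] <-]|v Sv].
    move=> P [[q Sq ->]|->].
      rewrite meval_c'_incl.
      have : zero_locus S (c x) by rewrite -img; exists x.
      by apply.
    by rewrite mevalB mevalM meval1 meval_c'_X0 meval_c'_incl mulVf// subrr.
  have Sv' : zero_locus S (fun i => v (lift ord0 i)).
    by move=> q Sq; rewrite -meval_incl; apply: Sv; left; exists q.
  move: Sv'; rewrite -img => -[x Ux cx].
  have : meval v (X0 * incl p - 1) = 0 by apply: Sv; right.
  rewrite mevalB mevalM meval1 mevalXU meval_incl -cx => /eqP.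
  rewrite subr_eq0 => /eqP vp1.
  have px0 : meval (c x) p != 0.
    by apply/eqP => p0; move/eqP: vp1; rewrite p0 mulr0 eq_sym oner_eq0.
  exists x; first by split.
  apply/funext => i; rewrite /c'; case: (unliftP ord0 i) => [j ->|->].
    by rewrite cx.
  by apply: (mulIf px0); rewrite mulVf.
- move=> V VD; have VU : V `<=` U by move=> x /VD[].
  rewrite (top V VU); split=> h x Vx; have [q [Dx DV]] := h x Vx.
    exists (incl q); split.
      by split; [exact: VD|rewrite /= meval_c'_incl; case: Dx].
    move=> y [[Uy py] qy]; apply: DV; split=> //.
    by move: qy; rewrite /= meval_c'_incl.
  have [q' [DE _]] := D'E q.
  by exists (p * q'); rewrite -DE.
- move=> P f; have [q [DE [M PE]]] := D'E P.
  have Dsub x : D' P x -> [/\ D p x, meval (c x) p != 0 & meval (c x) q != 0].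
    by rewrite DE basic_openM => -[[Ux px] [_ qx]].
  rewrite {1}DE chart_regfun -DE; split=> -[Q [N fE]].
    (* From P = q / p^M follows p q = P p^(M+1), so 1 / (p q)^N is X_0^((M+1) N) / P^N. *)
    exists (incl Q * X0 ^+ (M.+1 * N)), N => x; rewrite inE => Dx.
    rewrite fE//; have [Dpx px qx] := Dsub x Dx.
    have -> : meval (c' p x) (incl Q * X0 ^+ (M.+1 * N)) =
        meval (c x) Q * (meval (c x) p)^-1 ^+ (M.+1 * N).
      by rewrite mevalM rmorphXn /= meval_c'_X0 meval_c'_incl.
    have pM : meval (c x) p ^+ M != 0 by rewrite expf_neq0.
    rewrite PE// mevalM exprM -mulrA; congr (_ * _).
    rewrite -exprVn -expr_div_n; congr (_ ^+ _).
    by rewrite exprVn exprS; field; rewrite px qx pM.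
  have [Q' [M' QE]] := clear_denominators p Q.
  (* With Q = Q' / p^M', the quotient Q / P^N is Q' p^(M N) / (p^M' q^N); expanding by p^N q^M'
     makes the denominator a power of p q. *)
  exists (Q' * p ^+ (M * N + N) * q ^+ M'), (N + M')%N => x Dx.
  have [Dpx px qx] := Dsub x Dx.
  rewrite fE ?inE// QE// PE// !mevalM !rmorphXn /= expr_div_n !exprD !exprMn exprM.
  have pM : meval (c x) p ^+ M ^+ N != 0 by rewrite !expf_neq0.
  have pN : meval (c x) p ^+ N != 0 by rewrite expf_neq0.
  have qN : meval (c x) q ^+ N != 0 by rewrite expf_neq0.
  have pM' : meval (c x) p ^+ M' != 0 by rewrite expf_neq0.
  have qM' : meval (c x) q ^+ M' != 0 by rewrite expf_neq0.
  by field; rewrite pM pN qN pM' qM'.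
Qed.

End Chart.

End AffineCharts.

(** * Local properties of varieties *)

Section VarietyLocal.
Variables (k : closedFieldType) (X : variety k).

Lemma affine_basis (V : set X) x : open V -> V x ->
  exists A : set X, [/\ affine_open A, A x & A `<=` V].
Proof.
move=> oV Vx; have [n [U [aU covU]]] := var_affine_cover X.
have [i _ Ux] : (\bigcup_i U i) x by rewrite covU.
have [oU [d [c [S chart]]]] := affine_chart_ex (aU i).
have [p Dx DV] := basic_open_sub chart (openI oU oV) (@subIsetl _ _ _) (conj Ux Vx).
exists (basic_open (U i) c p); split=> //; first exact: basic_open_affine chart p.
by move=> y /DV[].
Qed.

(** In a general space with functions, a nonvanishing function need not be invertible nearby. Here
    the description of the sections on basic open sets provides the inverse. *)
Lemma unit_near (V : set X) f x : open V -> V x -> regfun X V f ->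
  f x != 0 -> exists V' : set X, [/\ open V', V' x, V' `<=` V & unit_on V' f].
Proof.
move=> oV Vx rf fx0; have [A [aA Ax AV]] := affine_basis oV Vx.
have [oA [d [c [S chart]]]] := affine_chart_ex aA.
have [V' [oV' V'x V'A uf]] := chart_unit_near chart oA (@subset_refl _ A) Ax
  (regfun_sub oV oA AV rf) fx0.
by exists V'; split=> //; exact: subset_trans AV.
Qed.

End VarietyLocal.

(** * Trivializing a line bundle near two points of an affine set *)

Section SemilocalTriviality.
Variables (k : closedFieldType) (X : fun_space k).

Lemma sec_glue2 E (A B O : set X) (s : sec E A) (t : sec E B) :
  open A -> open B -> A `|` B = O ->
  res (A `&` B) s = res (A `&` B) t ->
  exists w : sec E O, res A w = s /\ res B w = t.
Proof.
move=> oA oB ABO st; have oO : open O by rewrite -ABO; exact: openU.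
pose V (b : bool) := if b then A else B.
pose r (b : bool) : sec E (V b) := if b return sec E (V b) then s else t.
have [|||w wE] := @sec_glue _ _ E bool O V r oO.
- by case.
- by rewrite -ABO; apply/seteqP; split=> x [];
    [case=> _; [left|right]|exists true|exists false].
- case=> -[] //=; rewrite /V /=.
  by rewrite setIC.
by exists w; split; [exact: (wE true)|exact: (wE false)].
Qed.

(* On D p and D q the bundle is trivial; if f = r / (p q)^N is the ratio of the
   frames, then p^N e and (r / q^N) e' agree on D p and D q. *)
Lemma extend_frame E U n (c : X -> 'I_n -> k) S p q O
    (e : sec E (basic_open U c p)) (e' : sec E (basic_open U c q)) :
  affine_chart U c S -> frame1 e -> frame1 e' ->
  basic_open U c p `|` basic_open U c q = O ->
  exists (s : sec E O) f g,
  [/\ regfun X (basic_open U c p) f, regfun X (basic_open U c q) g,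
      res (basic_open U c p) s = act (basic_open U c p) f e,
      res (basic_open U c q) s = act (basic_open U c q) g e'
    & forall x, basic_open U c p x -> f x != 0].
Proof.
move=> chart fe fe' UO; set A := basic_open U c p; set B := basic_open U c q.
have [oA oB] := (frame1_open fe, frame1_open fe').
have oAB : open (A `&` B) by exact: openI.
have [rh eh] := fcoefP fe' (res (A `&` B) e) oAB (@subIsetr _ _ _).
set h := fcoef _ _ in rh eh.
have [r [N hE]] : exists r N, forall x, (A `&` B) x ->
    h x = meval (c x) r / meval (c x) (p * q) ^+ N.
  by move: rh; rewrite -(basic_openM U c); move/(chart_regfun chart).
pose f x := meval (c x) p ^+ N; pose g x := meval (c x) r / meval (c x) q ^+ N.
have rf : regfun X A f.
  apply/(chart_regfun chart); exists (p ^+ N), 0%N => x _.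
  by rewrite rmorphXn expr0 divr1.
have rg : regfun X B g by apply/(chart_regfun chart); exists r, N.
have [rfI rgI] := (regfun_sub oA oAB (@subIsetl _ _ _) rf,
                   regfun_sub oB oAB (@subIsetr _ _ _) rg).
have [|s [sA sB]] := sec_glue2 (s := act A f e) (t := act B g e') oA oB UO.
  rewrite !res_act//; try exact: subIsetl; try exact: subIsetr.
  rewrite eh -actM//; apply: eq_act => // x [Ax Bx].
  have [[_ /= pn0] [_ /= qn0]] := (Ax, Bx).
  rewrite hE// /f /g mevalM exprMn; field.
  by rewrite !expf_neq0.
exists s, f, g; split=> // x [_ /= pn0]; exact: expf_neq0.
Qed.

End SemilocalTriviality.

Section TwoPoints.
Variables (k : closedFieldType) (X : variety k).

(** Frames near x1 and x2, multiplied by suitable powers, extend to sections on the union of two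
    basic open sets, the first nonvanishing at x1 and the second at x2. One of these sections or
    their sum vanishes at neither point and is therefore a frame near both. *)
Lemma two_point_frame E (U : set X) x1 x2 : line_bundle E -> affine_open U ->
  U x1 -> U x2 ->
  exists (O : set X) (s : sec E O), [/\ O x1, O x2 & frame1 s].
Proof.
move=> lE aU Ux1 Ux2; have [oU [n [c [S chart]]]] := affine_chart_ex aU.
have loc x : U x -> exists p (e : sec E (basic_open U c p)),
    basic_open U c p x /\ frame1 e.
  move=> Ux; have [O [e [Ox fe]]] := lE x; have oO := frame1_open fe.
  have [p Dx DO] := basic_open_sub chart (openI oU oO) (@subIsetl _ _ _) (conj Ux Ox).
  have DO' : basic_open U c p `<=` O by move=> y /DO[].
  exists p, (res (basic_open U c p) e); split=> //.
  by apply: frame1_res => //; exact: open_basic chart p.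
have [p [e [px1 fe]]] := loc x1 Ux1; have [q [e' [qx2 fe']]] := loc x2 Ux2.
set A := basic_open U c p in e px1 fe; set B := basic_open U c q in e' qx2 fe'.
have [oA oB] := (frame1_open fe, frame1_open fe').
have oO : open (A `|` B) by exact: openU.
have [s1 [f1 [g1 [rf1 rg1 s1A s1B f1n0]]]] := extend_frame chart fe fe' erefl.
have [s2 [g2 [f2 [rg2 rf2 s2B s2A g2n0]]]] :=
  extend_frame chart fe' fe (setUC B A).
have fx1 := f1n0 _ px1; have gx2 := g2n0 _ qx2.
have [s [f [g [rf rg sA sB [fn0 gn0]]]]] : exists (s : sec E (A `|` B)) f g,
    [/\ regfun X A f, regfun X B g, res A s = act A f e, res B s = act B g e'
      & f x1 != 0 /\ g x2 != 0].
  have [g1x2|g1x2] := eqVneq (g1 x2) 0; last by exists s1, f1, g1.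
  have [f2x1|f2x1] := eqVneq (f2 x1) 0; last by exists s2, f2, g2.
  exists (s1 + s2), (fun x => f1 x + f2 x), (fun x => g1 x + g2 x).
  split; [exact: regfun_add|exact: regfun_add|..].
  - by rewrite res_D// ?s1A ?s2A ?actDl//; exact: subsetUl.
  - by rewrite res_D// ?s1B ?s2B ?actDl//; exact: subsetUr.
  - by rewrite g1x2 f2x1 add0r addr0.
have [A' [oA' A'x1 A'A uf]] := unit_near oA px1 rf fn0.
have [B' [oB' B'x2 B'B ug]] := unit_near oB qx2 rg gn0.
have oO' : open (A' `|` B') by exact: openU.
have O'O : A' `|` B' `<=` A `|` B by exact: setUSS.
exists (A' `|` B'), (res (A' `|` B') s); split; [by left|by right|].
have AO : A `<=` A `|` B by exact: subsetUl.
have BO : B `<=` A `|` B by exact: subsetUr.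
have A'O : A' `<=` A' `|` B' by exact: subsetUl.
have B'O : B' `<=` A' `|` B' by exact: subsetUr.
apply: frame1_local => // x [A'x|B'x].
  exists A'; split=> //; rewrite res_comp// -(res_comp s oO oA)// sA.
  by rewrite res_act//; exact: frame1_unit.
exists B'; split=> //; rewrite res_comp// -(res_comp s oO oB)// sB.
by rewrite res_act//; exact: frame1_unit.
Qed.

End TwoPoints.

(** * Conjugate points and neighborhoods of the fibres *)

Section DoubleCoverFibers.
Variables (k : closedFieldType) (X Y : variety k) (phi : morphism X Y).
Variables (N : modsheaf Y) (D : double_cover_structure phi N).

Lemma tau_unique (V : set Y) a (nu : sec N V) a' (nu' : sec N V) : open V ->
  regfun Y V a -> regfun Y V a' ->
  (forall x, V (phi x) -> a (phi x) + tau D nu x = a' (phi x) + tau D nu' x) ->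
  (forall y, V y -> a y = a' y) /\ nu = nu'.
Proof.
move=> oV ra ra' e; have rs := regfun_add oV ra (regfun_opp oV ra').
have [|a0 nu0] := @tau_direct _ _ _ _ _ D V _ (nu - nu') oV rs.
  move=> x; rewrite inE => Vx.
  have tN : tau D (- nu') x = - tau D nu' x.
    by apply/eqP; rewrite -addr_eq0 -tauD// addNr tau0.
  by rewrite tauD// tN addrACA -opprD e// subrr.
split; last by apply/eqP; rewrite -subr_eq0 nu0.
by move=> y Vy; apply/eqP; rewrite -subr_eq0 a0// inE.
Qed.

(* The functions on the affine set phi^-1 V are the a + tau nu, and
   a + tau nu |-> (a - tau nu) x1 is an algebra homomorphism, hence the
   evaluation at a point. *)
Lemma conjugate_point (V : set Y) x1 : affine_open V ->
  affine_open (phi @^-1` V) -> V (phi x1) ->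
  exists x2, phi x2 = phi x1 /\
    forall nu : sec N V, tau D nu x2 = - tau D nu x1.
Proof.
move=> aV aW Vx1; have [oV [nV [cV [SV chartV]]]] := affine_chart_ex aV.
have [oW [n [c [S chart]]]] := affine_chart_ex aW.
pose rep (p : mpoly n k) a (nu : sec N V) := regfun Y V a /\
  forall x, V (phi x) -> meval (c x) p = a (phi x) + tau D nu x.
have repE p : exists anu : (Y -> k) * sec N V, rep p anu.1 anu.2.
  have rp : regfun X (phi @^-1` V) (fun x => meval (c x) p).
    by apply/(chart_regfun1 chart); exists p.
  have [a [nu [ra pE]]] := tau_split D oV rp; exists (a, nu); split=> //= x Vx.
  by apply: pE; rewrite inE.
have [r rP] := choice repE.
pose chi p := (r p).1 (phi x1) - tau D (r p).2 x1.
have chiE p a nu : rep p a nu -> chi p = a (phi x1) - tau D nu x1.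
  move=> [ra pE]; have [rr pE'] := rP p.
  have [|a0 nu0] := tau_unique (nu := (r p).2) (nu' := nu) oV rr ra.
    by move=> x Vx; rewrite -pE// pE'.
  by rewrite /chi a0// nu0.
pose v i := chi (mpolyX k (mnm1 i)).
have vE p : meval v p = chi p.
  elim/mpoly_ring_ind: p => [a|i|p q ep eq|p q ep eq].
  - rewrite mevalC (@chiE _ (fun=> a) 0) ?tau0 ?subr0//.
    by split=> [|x Vx]; rewrite ?mevalC ?tau0 ?addr0//; exact: regfun_cst.
  - by rewrite mevalXU.
  - have [[rp pE] [rq qE]] := (rP p, rP q).
    rewrite mevalD ep eq.
    rewrite (@chiE (p + q) (fun y => (r p).1 y + (r q).1 y) ((r p).2 + (r q).2)).
      by rewrite tauD// /chi; ring.
    split=> [|x Vx]; first exact: regfun_add.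
    by rewrite mevalD pE// qE// tauD//; ring.
  - have [[rp pE] [rq qE]] := (rP p, rP q).
    have rpq := regfun_mul oV rp rq.
    have rF := branch_eq_reg D (r p).2 (r q).2 oV.
    rewrite mevalM ep eq.
    rewrite (@chiE (p * q) 
      (fun y => (r p).1 y * (r q).1 y + branch_eq D (r p).2 (r q).2 y)
      (act V (r p).1 (r q).2 + act V (r q).1 (r p).2)).
      by rewrite tauD// !tauZ// -tauM// /chi; ring.
    split=> [|x Vx]; first exact: regfun_add.
    by rewrite mevalM pE// qE// tauD// !tauZ// -tauM//; ring.
have [injV _ _ _] := chartV; have [_ img _ _] := chart.
(* A polynomial in S vanishes on the whole of phi^-1 V, so its representation is (0, 0) and chi
   kills it. *)
have Sv : zero_locus S v.
  move=> p Sp; rewrite vE (@chiE _ (fun=> 0) 0) ?tau0 ?subr0//.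
  split=> [|x Vx]; first exact: regfun_cst.
  rewrite tau0// addr0; have : zero_locus S (c x) by rewrite -img; exists x.
  by apply.
move: Sv; rewrite -img => -[x2 Vx2 cx2]; exists x2.
have evalE f a (nu : sec N V) : regfun X (phi @^-1` V) f -> regfun Y V a ->
    (forall x, V (phi x) -> f x = a (phi x) + tau D nu x) ->
    f x2 = a (phi x1) - tau D nu x1.
  move=> /(chart_regfun1 chart)[p pE] ra fE.
  rewrite pE// cx2 vE (@chiE _ a nu)//; split=> // x Vx.
  by rewrite -fE// pE.
split.
  (* Functions pulled back from V have no tau part, so they have the same value at x1 and x2; the
     coordinates of V separate points. *)
  apply: injV; rewrite ?inE//; apply/funext => i.
  have rc := regfun_coord chartV i; have rc' := morph_regfun phi oV rc.
  have := evalE _ _ 0 rc' rc; rewrite tau0// subr0; apply=> x Vx.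
  by rewrite tau0// addr0.
move=> nu; rewrite (evalE (tau D nu) (fun=> 0) nu) ?sub0r//.
- exact: tau_regfun.
- exact: regfun_cst.
- by move=> x _; rewrite add0r.
Qed.

(* O contains D f for some f = a + tau nu that does not vanish at x1 and x2; the
   norm a^2 - (tau nu)^2 of f does not vanish at phi x1. *)
Lemma fiber_neighborhood (V : set Y) (O : set X) x1 x2 : affine_open V ->
  affine_open (phi @^-1` V) -> V (phi x1) -> phi x2 = phi x1 ->
  (forall nu : sec N V, tau D nu x2 = - tau D nu x1) ->
  open O -> O x1 -> O x2 ->
  exists V' : set Y, [/\ open V', V' (phi x1), V' `<=` V & phi @^-1` V' `<=` O].
Proof.
move=> aV aW Vx1 x21 tx21 oO Ox1 Ox2.
have [oV _] := aV; have [oW [n [c [S chart]]]] := affine_chart_ex aW.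
have Vx2 : V (phi x2) by rewrite x21.
have oWO : open ((phi @^-1` V) `&` O) by exact: openI.
have loc x : V (phi x) -> O x -> exists2 p, meval (c x) p != 0 &
    forall z, V (phi z) -> meval (c z) p != 0 -> O z.
  move=> Vx Ox.
  have [p [_ px] pO] := basic_open_sub chart oWO (@subIsetl _ _ _) (conj Vx Ox).
  by exists p => // z Vz pz; have [] := pO z (conj Vz pz).
have [p1 p1x1 p1O] := loc x1 Vx1 Ox1; have [p2 p2x2 p2O] := loc x2 Vx2 Ox2.
have [f [fx1 fx2 fO]] : exists f, [/\ meval (c x1) f != 0, meval (c x2) f != 0 &
    forall z, V (phi z) -> meval (c z) f != 0 -> O z].
  have [p1x2|p1x2] := eqVneq (meval (c x2) p1) 0; last by exists p1.
  have [p2x1|p2x1] := eqVneq (meval (c x1) p2) 0; last by exists p2.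
  (* Where the sum does not vanish, p1 or p2 does not vanish, which is enough to lie in O. *)
  exists (p1 + p2); rewrite !mevalD p1x2 p2x1 add0r addr0; split=> // z Vz.
  rewrite mevalD; have [p1z|p1z _] := eqVneq (meval (c z) p1) 0; last exact: p1O.
  by rewrite p1z add0r; exact: p2O.
have rf : regfun X (phi @^-1` V) (fun x => meval (c x) f).
  by apply/(chart_regfun1 chart); exists f.
have [a [nu [ra fE]]] := tau_split D oV rf.
have {}fE x : V (phi x) -> meval (c x) f = a (phi x) + tau D nu x.
  by move=> Vx; apply: fE; rewrite inE.
pose nm y := a y * a y + - branch_eq D nu nu y.
have rnm : regfun Y V nm.
  exact: (regfun_add oV (regfun_mul oV ra ra)
    (regfun_opp oV (branch_eq_reg D nu nu oV))).
(* The norm is a function on Y that is a multiple of f upstairs; where it does not vanish, f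
   vanishes nowhere on the fibre. *)
have nmE x : V (phi x) -> nm (phi x) = (a (phi x) - tau D nu x) * meval (c x) f.
  by move=> Vx; rewrite fE// /nm -tauM//; ring.
have nmx1 : nm (phi x1) != 0.
  by rewrite nmE// mulf_neq0// -tx21 -x21 -fE.
have [V' [oV' V'x1 V'V unm]] := unit_near oV Vx1 rnm nmx1.
exists V'; split=> // x V'x; have Vx := V'V _ V'x.
apply: fO => //; have := unit_on_neq0 unm V'x.
by rewrite nmE// mulf_eq0 negb_or => /andP[].
Qed.

(** Surjectivity gives a point x1 over y, and finiteness an affine phi^-1 V that contains x1 and its
    conjugate. A frame near these two points is a frame on the preimage of a neighborhood of y. *)
Lemma line_bundle_push_frame E y : finite_morphism phi -> range phi = setT ->
  line_bundle E -> exists (V : set Y) (e : sec E (phi @^-1` V)),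
    [/\ open V, V y & frame1 e].
Proof.
move=> fin surj lE; have [V [Vy aV aW _]] := fin y.
have : range phi y by rewrite surj.
move=> [x1 _ x1y]; rewrite -x1y in Vy *.
have [x2 [x21 tx21]] := conjugate_point aV aW Vy.
have Vx2 : V (phi x2) by rewrite x21.
have [O [s [Ox1 Ox2 fs]]] := two_point_frame lE aW Vy Vx2.
have oO := frame1_open fs.
have [V' [oV' V'y V'V V'O]] := fiber_neighborhood aV aW Vy x21 tx21 oO Ox1 Ox2.
exists V', (res (phi @^-1` V') s); split=> //.
by apply: frame1_res => //; exact: open_preimage.
Qed.

(** Over a smaller phi^-1 V' there is a frame e'. Writing s = f e' and e' = g s gives g f = 1, so s
    is a unit multiple of a frame; in rank one, generation implies freeness. *)
Lemma generated_frame1 E (V : set Y) (s : sec E (phi @^-1` V)) :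
  finite_morphism phi -> range phi = setT -> line_bundle E -> open V ->
  (forall V', open V' -> V' `<=` V -> forall s' : sec E (phi @^-1` V'),
     exists2 f, regfun X (phi @^-1` V') f
       & s' = act (phi @^-1` V') f (res (phi @^-1` V') s)) -> frame1 s.
Proof.
move=> fin surj lE oV gen; apply: frame1_local; first exact: open_preimage.
move=> x Vx; have [V1 [e [oV1 V1x fe]]] := line_bundle_push_frame (phi x) fin surj lE.
pose V' := V `&` V1; have oV' : open V' by exact: openI.
have V'V : V' `<=` V by exact: subIsetl.
have oW' : open (phi @^-1` V') by exact: open_preimage.
have W'W1 : phi @^-1` V' `<=` phi @^-1` V1 by move=> ? [].
exists (phi @^-1` V'); split=> //; first by move=> ? [].
set s' := res (phi @^-1` V') s; pose e' := res (phi @^-1` V') e.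
have fe' : frame1 e' by exact: frame1_res.
have [rf fE] := fcoefP fe' s' oW' (@subset_refl _ _).
have [g rg gE] := gen V' oV' V'V e'.
rewrite res_id// in fE; set f := fcoef e' s' in rf fE.
have rfg := regfun_mul oW' rg rf.
have fg z : V' (phi z) -> g z * f z = 1.
  have := frame1_inj fe' oW' (@subset_refl _ _) rfg (regfun_cst 1 oW').
  by apply; rewrite act1// res_id// actM// -fE -/s' -gE.
have := frame1_unit fe' oW' (@subset_refl _ _) (f := f).
rewrite res_id// -fE; apply; split=> //; exists g => // z.
by rewrite inE => Vz; rewrite mulrC fg.
Qed.

End DoubleCoverFibers.

(** * Units in the rings of regular functions *)

Section Units.
Variables (k : closedFieldType) (X : fun_space k).
Implicit Types (U V : set X) (f g : X -> k).

Lemma unit_on_mul U f g : open U -> unit_on U f -> unit_on U g ->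
  unit_on U (fun x => f x * g x).
Proof.
move=> oU [rf [f' rf' ff']] [rg [g' rg' gg']]; split; first exact: regfun_mul.
exists (fun x => f' x * g' x) => [|x Ux]; first exact: regfun_mul.
by rewrite mulrACA ff'// gg'// mulr1.
Qed.

Lemma unit_onV U f : open U -> unit_on U f -> unit_on U (fun x => (f x)^-1).
Proof.
move=> oU uf; split; first exact: unit_on_inv.
exists f => [|x]; first by case: uf.
by rewrite inE => Ux; rewrite mulVf// (unit_on_neq0 uf Ux).
Qed.

Lemma eq_unit_on U f g : open U -> (forall x, U x -> f x = g x) ->
  unit_on U f -> unit_on U g.
Proof.
move=> oU fg [rf [h rh fh]]; split; first exact: eq_regfun rf.
by exists h => // x Ux; rewrite -fg ?fh// -inE.
Qed.

Lemma unit_on_sub U V f : open U -> open V -> V `<=` U ->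
  unit_on U f -> unit_on V f.
Proof.
move=> oU oV VU [rf [g rg fg]]; split; first exact: regfun_sub rf.
exists g => [|x]; first exact: regfun_sub rg.
by rewrite inE => /VU Ux; rewrite fg ?inE.
Qed.

End Units.

(** * From transition functions on X to those of the direct image *)

Section PushforwardTransitions.
Variables (k : closedFieldType) (X Y : variety k) (phi : morphism X Y).
Variables (N : modsheaf Y) (D : double_cover_structure phi N).
Variables (I : Type) (U : I -> set Y) (nu : forall i, sec N (U i)).
Variable xi : I -> I -> Y -> k.
Hypothesis nu_xi : transition_by (fun i (_ : 'I_1) => nu i)
  (fun i j y => (xi i j y)%:M : 'M_1).

Let W i : set X := phi @^-1` U i.
Let t i : X -> k := tau D (nu i).

Lemma transition_frame1 i : frame1 (nu i).
Proof. by case: nu_xi => fn _ _; exact: fn. Qed.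

Let oU i : open (U i). Proof. exact: frame1_open (transition_frame1 i). Qed.
Let oUI i j : open (U i `&` U j). Proof. exact: openI. Qed.
Let oW i : open (W i). Proof. exact: open_preimage. Qed.

Lemma transition_unit_on i j : unit_on (U i `&` U j) (xi i j).
Proof. by case: nu_xi => _ gl _; exact: GL1_unit_on. Qed.

Lemma preimage_unit_on V f : open V -> unit_on V f ->
  unit_on (phi @^-1` V) (f \o phi).
Proof.
move=> oV [rf [g rg fg]]; split; first exact: morph_regfun.
exists (g \o phi) => [|x]; first exact: morph_regfun.
by rewrite inE => Vx; rewrite /= fg ?inE.
Qed.

Lemma tau_transition i j x : (U i `&` U j) (phi x) ->
  t j x = xi i j (phi x) * t i x.
Proof.
move=> Ux; have [_ _ ext] := nu_xi.
have := ext i j 0; rewrite big_ord1 => nuj.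
have -> : t j x = tau D (res (U i `&` U j) (nu j)) x.
  by rewrite (tau_res D (nu j) (oU j) (oUI i j) (@subIsetr _ _ _)) ?inE.
rewrite nuj.
have -> : act (U i `&` U j) (fun y => ((xi i j y)%:M : 'M_1) 0 0)
      (res (U i `&` U j) (nu i)) =
    act (U i `&` U j) (xi i j) (res (U i `&` U j) (nu i)).
  by apply: eq_act => // y _; rewrite mxE eqxx.
have [rxi _] := transition_unit_on i j.
exact: (tau_act D (transition_frame1 i) (oUI i j) (@subIsetl _ _ _) rxi Ux).
Qed.

Lemma sum_ord2 (V : zmodType) (f : 'I_2 -> V) : \sum_(a < 2) f a = f 0 + f 1.
Proof.
rewrite !big_ord_recl big_ord0 addr0 (_ : lift ord0 ord0 = 1)//.
exact: val_inj.
Qed.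

Lemma push_transition_by E (w : forall i, sec E (W i)) (u : I -> I -> X -> k)
    (K : I -> I -> Y -> 'M[k]_2) : transition1 w u ->
  (forall i j, mul_matrix D (nu i) (U i `&` U j) (u i j) (K i j)) ->
  transition_by (E := pushforward phi E) (fun i => push_frame D (nu i) (w i))
    (fun i j y => K i j y *m mx2 1 0 0 (xi i j y)).
Proof.
move=> tw uK; have tE : has_transition1 W E u by exists w.
have [fw uw] := tw.
split=> [i|i j|i j b].
- have := push_frameP D (transition_frame1 i) (fw i). exact.
- apply: GL_on_mul => //; last exact: GL_on_diag (oUI i j) (transition_unit_on i j).
  apply: (mul_matrix_GL (transition_frame1 i) (oUI i j) (@subIsetl _ _ _)) (uK i j).
  by have [] := has_transition1_unit i j tE.
have [p [q [rp rq KE uE]]] := uK i j; have [ru eij] := uw i j.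
set V := U i `&` U j in KE uE rp rq *.
have oV : open V by exact: oUI.
have oV' : open (phi @^-1` V) by exact: open_preimage.
have rti : regfun X (phi @^-1` V) (t i).
  by have := tau_regfun_sub D (transition_frame1 i) oV (@subIsetl _ _ _).
have rtj : regfun X (phi @^-1` V) (t j).
  by have := tau_regfun_sub D (transition_frame1 j) oV (@subIsetr _ _ _).
have rt i' : regfun X (phi @^-1` U i') (t i') by exact: tau_regfun.
have ViI : phi @^-1` V `<=` phi @^-1` U i by move=> x [].
have VjI : phi @^-1` V `<=` phi @^-1` U j by move=> x [].
have rK a c : regfun Y V (fun y => (K i j y *m mx2 1 0 0 (xi i j y)) a c).
  have [rxi _] := transition_unit_on i j.
  apply: (@eq_regfun _ _ _ (fun y =>
      if c == 0 then K i j y a 0 else K i j y a 1 * xi i j y)) => //.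
    move=> y _; rewrite mulmx2E !mx2E !mxE /=.
    by case: (ord2P c) => -> /=; rewrite ?mulr1 ?mulr0 ?addr0 ?add0r.
  have rKab a' b' :=
    mul_matrix_regfun (transition_frame1 i) a' b' oV (@subIsetl _ _ _) (uK i j).
  by case: (c == 0) => //; exact: (regfun_mul oV (rKab a 1) rxi).
rewrite sum_ord2 /push_frame /=.
have rK0 := morph_regfun phi oV (rK 0 b).
have rK1 := morph_regfun phi oV (rK 1 b).
have rKt := regfun_mul oV' rK1 rti.
have oU' i' : open (phi @^-1` U i') by exact: oW.
rewrite [X in _ = _ + act _ _ X]res_act// -actM// -actDl//.
have eij' : res (phi @^-1` V) (w j) =
  act (phi @^-1` V) (u i j) (res (phi @^-1` V) (w i)) by exact: eij.
(* The first column expresses w_j = u_ij w_i. The second one expresses t_j w_j = xi_ij t_i u_ij w_i,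
   whence the factor diag(1, xi_ij). *)
case: (ord2P b) => -> /=.
  rewrite eij'; apply: eq_act => // x Vx /=.
  rewrite uE// KE//; rewrite !mulmx2E !mx2E !mxE /=; ring.
rewrite res_act// eij' -actM//; apply: eq_act => // x Vx /=.
rewrite uE// KE// -/(t i x) -/(t j x) (tau_transition Vx).
rewrite !mulmx2E !mx2E !mxE /= -(tau_sqr D (transition_frame1 i) (proj1 Vx)).

rewrite -/(t i x); ring.
Qed.

(** * The multiplications described by a good representation *)

Section GoodRepresentation.
Hypotheses (fin : finite_morphism phi) (surj : range phi = setT).

(* With s_i the first vector of the frame on U_i, u_ij = s_j / s_i; and the dual
   bundle has the frame a1_i / s_i, whose transition functions are v_ij. *)
Lemma good_representation_transition1 E G a0 a1 a2 : line_bundle E ->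
  good_representation nu (mul_t D (L := E)) G a0 a1 a2 ->
  exists u v : I -> I -> X -> k,
  [/\ has_transition1 W E u,
      forall E', is_dual E E' -> has_transition1 W E' v,
      forall i j, unit_on (W i `&` W j) (v i j),
      forall i j, mul_matrix D (nu i) (U i `&` U j) (u i j)
                    (K_plus D nu G a0 a1 i j)
    & forall i j, mul_matrix D (nu i) (U i `&` U j) (v i j)
                    (K_minus D nu xi G a0 a1 i j)].
Proof.
move=> lE [[e [[fe gG eG] ra Me]] ua1].
have ra0 i : regfun Y (U i) (a0 i) by case: (ra i).
have ra1 i : regfun Y (U i) (a1 i) by case: (ra i).
have rt i : regfun X (W i) (t i) by exact: tau_regfun.
pose s i : sec E (W i) := e i 0.
have a1n0 i x : W i x -> a1 i (phi x) != 0 by exact: (unit_on_neq0 (ua1 i)).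
(* The first column of M_i reads t s = a0 s + a1 e_1. As a1 is a unit, this can be solved for e_1 =
   w s, so s alone generates. *)
pose w i x := (t i x - a0 i (phi x)) / a1 i (phi x).
have rb i : regfun Y (U i) (fun y => (a1 i y)^-1) by exact: unit_on_inv.
have rb' i : regfun X (W i) (fun x => (a1 i (phi x))^-1).
  exact: (morph_regfun phi (oU i) (rb i)).
have ra0' i : regfun X (W i) (a0 i \o phi) by exact: morph_regfun.
have ra1' i : regfun X (W i) (a1 i \o phi) by exact: morph_regfun.
have rta i : regfun X (W i) (fun x => t i x - a0 i (phi x)).
  exact: (regfun_add (oW i) (rt i) (regfun_opp (oW i) (ra0' i))).
have rw i : regfun X (W i) (w i) by exact: (regfun_mul (oW i) (rta i) (rb' i)).
have Ms i : act (W i) (t i) (s i) =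
    act (W i) (a0 i \o phi) (s i) + act (W i) (a1 i \o phi) (e i 1).
  have := Me i 0; rewrite /mul_t sum_ord2 => -> /=.
  by congr (_ + _); apply: eq_act => // x _ /=; rewrite mx2E mxE.
have e1E i : e i 1 = act (W i) (w i) (s i) :> sec E (W i).
  have -> : act (W i) (w i) (s i) =
      act (W i) (fun x => (a1 i (phi x))^-1)
        (act (W i) (fun x => t i x - a0 i (phi x)) (s i)).
    by rewrite -actM//; apply: eq_act => // x _; rewrite mulrC.
  have rN := regfun_opp (oW i) (ra0' i).
  rewrite actDl// Ms act_N// addrAC subrr add0r -actM//.
  rewrite -[LHS]act1//; apply: eq_act => // x Wx /=.
  by rewrite mulVf// a1n0.
have fs i : frame1 (s i).
  apply: (generated_frame1 D) => // V oV VU s'.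
  have oV' := open_preimage phi oV.
  have VW : phi @^-1` V `<=` W i by move=> x /VU.
  have [_ /(_ V oV VU)[gen _]] := fe i.
  have [f rf] := gen s'; rewrite sum_ord2 /= => ->.
  have [rf0 rf1] := (morph_regfun phi oV (rf 0), morph_regfun phi oV (rf 1)).
  have rwV := regfun_sub (oW i) oV' VW (rw i).
  have rfw := regfun_mul oV' rf1 rwV.
  exists (fun x => f 0 (phi x) + f 1 (phi x) * w i x); first exact: regfun_add.
  rewrite actDl// actM// e1E res_act//; [exact: oW|exact: rw].
(* Substituting e_1 = w s into s_j = g_11 s_i + g_21 e_1 yields s_j = u_ij s_i with u_ij = (A + g_21
   t_i) / a1_i. *)
pose A i j y := a1 i y * G i j y 0 0 - a0 i y * G i j y 1 0.
pose u i j x := (A i j (phi x) + G i j (phi x) 1 0 * t i x) / a1 i (phi x).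
have oV i j : open (U i `&` U j) by exact: openI.
have VWi i j : phi @^-1` (U i `&` U j) `<=` W i by move=> x [].
have VWj i j : phi @^-1` (U i `&` U j) `<=` W j by move=> x [].
have oV' i j : open (phi @^-1` (U i `&` U j)) by exact: open_preimage.
have rG i j a b : regfun Y (U i `&` U j) (fun y => G i j y a b).
  by case: (gG i j) => rG _; exact: rG.
have rwV i j := regfun_sub (oW i) (oV' i j) (@VWi i j) (rw i).
have eG' i j b : res (phi @^-1` (U i `&` U j)) (e j b : sec E (W j)) =
    act (phi @^-1` (U i `&` U j))
      (fun x => G i j (phi x) 0 b + G i j (phi x) 1 b * w i x)
      (res (phi @^-1` (U i `&` U j)) (s i)).
  have := eG i j b; rewrite sum_ord2 /= => ->.
  have rG0 := morph_regfun phi (oV i j) (rG i j 0 b).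
  have rG1 := morph_regfun phi (oV i j) (rG i j 1 b).
  have rGw := regfun_mul (oV' i j) rG1 (rwV i j).
  rewrite actDl// actM// e1E [X in _ + act _ _ X]res_act//; [exact: oW|exact: rw].
have uE i j x : (U i `&` U j) (phi x) ->
    G i j (phi x) 0 0 + G i j (phi x) 1 0 * w i x = u i j x.
  move=> [Ui Uj]; have := a1n0 i x Ui; rewrite /u /w /A => a1n.
  by field.
have rA i j : regfun Y (U i `&` U j) (A i j).
  have ra0V := regfun_sub (oU i) (oV i j) (@subIsetl _ _ _) (ra0 i).
  have ra1V := regfun_sub (oU i) (oV i j) (@subIsetl _ _ _) (ra1 i).
  exact: (regfun_add (oV i j) (regfun_mul (oV i j) ra1V (rG i j 0 0))
    (regfun_opp (oV i j) (regfun_mul (oV i j) ra0V (rG i j 1 0)))).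
have rbV i j := regfun_sub (oU i) (oV i j) (@subIsetl _ _ _) (rb i).
have tu : has_transition1 W E u.
  exists s; split=> // i j; split.
    have rtV := regfun_sub (oW i) (oV' i j) (@VWi i j) (rt i).
    have rbV' := morph_regfun phi (oV i j) (rbV i j).
    have rA' := morph_regfun phi (oV i j) (rA i j).
    have rG' := morph_regfun phi (oV i j) (rG i j 1 0).
    have rGt := regfun_mul (oV' i j) rG' rtV.
    exact: (regfun_mul (oV' i j) (regfun_add (oV' i j) rA' rGt) rbV').
  rewrite /s (eG' i j 0).
  by apply: (eq_act _ (oV' i j)) => x Vx; exact: uE.
have [us [su uu]] := tu.
have rF i j := branch_eq_regfun D (transition_frame1 i) (oV i j) (@subIsetl _ _ _).
have rxi i j : regfun Y (U i `&` U j) (xi i j) by case: (transition_unit_on i j).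
(* Both sides of t_j s_j = a0_j s_j + a1_j e_j1 are multiples of s_i; comparing
   the coefficients of 1 and t_i gives the norm of u_ij. *)
have norm i j y : (U i `&` U j) y ->
    xi i j y * (A i j y ^+ 2 - G i j y 1 0 ^+ 2 * F_loc D nu i y) =
    a1 i y * a1 j y * \det (G i j y).
  have ra0i := regfun_sub (oU i) (oV i j) (@subIsetl _ _ _) (ra0 i).
  have ra1i := regfun_sub (oU i) (oV i j) (@subIsetl _ _ _) (ra1 i).
  have ra0j := regfun_sub (oU j) (oV i j) (@subIsetr _ _ _) (ra0 j).
  have ra1j := regfun_sub (oU j) (oV i j) (@subIsetr _ _ _) (ra1 j).
  have rM f g := @regfun_mul _ _ _ f g (oV i j).
  have rD f g := @regfun_add _ _ _ f g (oV i j).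
  have rN f := @regfun_opp _ _ _ f (oV i j).
  (* p + q t_i is a1_i times the difference of the coefficients of the two sides along s_i, hence p
     = q = 0. *)
  pose q y := xi i j y * A i j y + - (a0 j y * G i j y 1 0 + a1 j y * G i j y 1 1).
  pose p y := xi i j y * (G i j y 1 0 * F_loc D nu i y) +
    - (a0 j y * A i j y + a1 j y * (a1 i y * G i j y 0 1 + - (a0 i y * G i j y 1 1))).
  have rq : regfun Y (U i `&` U j) q.
    exact: (rD _ _ (rM _ _ (rxi i j) (rA i j)) (rN _ (rD _ _ (rM _ _ ra0j (rG i j 1 0))
      (rM _ _ ra1j (rG i j 1 1))))).
  have rp : regfun Y (U i `&` U j) p.
    exact: (rD _ _ (rM _ _ (rxi i j) (rM _ _ (rG i j 1 0) (rF i j)))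
      (rN _ (rD _ _ (rM _ _ ra0j (rA i j)) (rM _ _ ra1j (rD _ _ (rM _ _ ra1i (rG i j 0 1))
        (rN _ (rM _ _ ra0i (rG i j 1 1)))))))).
  move=> Vy; have [|p0 q0] := frame_direct (D := D) (transition_frame1 i)
    (oV i j) (@subIsetl _ _ _) rp rq _ Vy.
    move=> x Vx; have [Uix Ujx] := Vx.
    have ra0j' := morph_regfun phi (oV i j) ra0j.
    have ra1j' := morph_regfun phi (oV i j) ra1j.
    have rtj := regfun_sub (oW j) (oV' i j) (@VWj i j) (rt j).
    pose g b x := G i j (phi x) 0 b + G i j (phi x) 1 b * w i x.
    have rg b : regfun X (phi @^-1` (U i `&` U j)) (g b).
      have rG0 := morph_regfun phi (oV i j) (rG i j 0 b).
      have rG1 := morph_regfun phi (oV i j) (rG i j 1 b).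
      exact: (regfun_add (oV' i j) rG0 (regfun_mul (oV' i j) rG1 (rwV i j))).
    have := congr1 (res (phi @^-1` (U i `&` U j))) (Ms j).
    rewrite res_D// !res_act// /s !eG' -/(g 0) -/(g 1) -!actM// -actDl//;
      try exact: regfun_mul.
    have rL := regfun_mul (oV' i j) rtj (rg 0).
    have rR := regfun_add (oV' i j) (regfun_mul (oV' i j) ra0j' (rg 0))
      (regfun_mul (oV' i j) ra1j' (rg 1)).
    move=> eqs; have := frame1_inj (fs i) (oV' i j) (@VWi i j) rL rR eqs Vx.
    rewrite (tau_transition Vx) /g /w /=.
    have := a1n0 i x Uix; set al := a1 i (phi x) => aln eqx.
    have := tau_sqr D (transition_frame1 i) Uix; rewrite -/(F_loc D nu i) -/(t i x) => tF.
    rewrite /p /q -tF /A -/al.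
    have /eqP := congr1 (fun z => z * al) eqx; rewrite -subr_eq0 => /eqP <-.
    by rewrite -/(t i x); field.
  (* In A q - g_21 p the terms with a0_j cancel, and those with a1_j combine into the
     determinant. *)
  have -> : xi i j y * (A i j y ^+ 2 - G i j y 1 0 ^+ 2 * F_loc D nu i y) =
      a1 i y * a1 j y * \det (G i j y) + A i j y * q y - G i j y 1 0 * p y.
    by rewrite det_mx2 /p /q /A; ring.
  by rewrite p0 q0 !mulr0 subr0 addr0.
(* Up to a factor from Y this is the conjugate of u_ij; by the norm formula, u_ij v_ij = a1_j /
   a1_i. *)
pose v i j x := xi i j (phi x) / (a1 i (phi x) * \det (G i j (phi x))) *
  (A i j (phi x) - G i j (phi x) 1 0 * t i x).
have vE i j x : (W i `&` W j) x -> u j i x * a1 j (phi x) / a1 i (phi x) = v i j x.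
  move=> Vx; have [Ui Uj] := Vx.
  have [_ uij] := has_transition1_unit i j tu; have un0 := unit_on_neq0 uij Vx.
  have uu1 : u i j x * u j i x = 1 by exact: (transition1_inv (conj su uu) Vx).
  apply: (mulfI un0).
  have -> : u i j x * (u j i x * a1 j (phi x) / a1 i (phi x)) =
      u i j x * u j i x * (a1 j (phi x) / a1 i (phi x)) by rewrite !mulrA.
  rewrite uu1 mul1r.
  have dn0 : \det (G i j (phi x)) != 0.
    by apply: (unit_on_neq0 (det_unit_on (oV i j) (gG i j))).
  have := norm i j (phi x) Vx.
  have := tau_sqr D (transition_frame1 i) Ui; rewrite -/(F_loc D nu i) -/(t i x) => <- nE.
  have an0 := a1n0 i x Ui.
  have -> : u i j x * v i j x = xi i j (phi x) * (A i j (phi x) ^+ 2 -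
      G i j (phi x) 1 0 ^+ 2 * (t i x * t i x)) /
      (a1 i (phi x) ^+ 2 * \det (G i j (phi x))).
    by rewrite /u /v; field; rewrite dn0.
  by rewrite nE; field; rewrite dn0.
have ua1' i : unit_on (W i) (fun x => a1 i (phi x)).
  exact: (preimage_unit_on (oU i) (ua1 i)).
have rdet i j : regfun Y (U i `&` U j)
    (fun y => xi i j y / (a1 i y * \det (G i j y))).
  have ud := det_unit_on (oV i j) (gG i j).
  have ua := unit_on_sub (oU i) (oV i j) (@subIsetl _ _ _) (ua1 i).
  have := unit_on_inv (oV i j) (unit_on_mul (oV i j) ua ud).
  exact: regfun_mul.
exists u, v; split=> // [E' dE|i j|i j|i j].
- have := rescale_transition1 (dual_transition1 dE tu) ua1'.
  by apply: eq_has_transition1; exact: vE.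
- have [oI uji] := has_transition1_unit j i tu.
  rewrite setIC in oI uji.
  apply: (eq_unit_on oI (vE i j)); apply: unit_on_mul => //.
    apply: unit_on_mul => //; exact: (unit_on_sub (oW j) oI (@subIsetr _ _ _)).
  apply: unit_onV => //; exact: (unit_on_sub (oW i) oI (@subIsetl _ _ _)).
- exists (fun y => (a1 i y)^-1 * A i j y), (fun y => (a1 i y)^-1 * G i j y 1 0); split.
  + exact: (regfun_mul (oV i j) (rbV i j) (rA i j)).
  + exact: (regfun_mul (oV i j) (rbV i j) (rG i j 1 0)).
  + by move=> y Vy; rewrite /K_plus scalerDr scale_scalar_mx scalerA.
  + by move=> x Vx; rewrite /u mulrC mulrDr mulrA.
- exists (fun y => xi i j y / (a1 i y * \det (G i j y)) * A i j y),
    (fun y => xi i j y / (a1 i y * \det (G i j y)) * - G i j y 1 0); split.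
  + exact: (regfun_mul (oV i j) (rdet i j) (rA i j)).
  + exact: (regfun_mul (oV i j) (rdet i j) (regfun_opp (oV i j) (rG i j 1 0))).
  + move=> y Vy; rewrite /K_minus scalerDr scale_scalar_mx scalerN scalerA.
    by rewrite mulrN scaleNr.
  + by move=> x Vx; rewrite /v mulrBr mulrN mulNr mulrA.
Qed.

Lemma good_representation_present m (Ls : 'I_m -> modsheaf X) G a0 a1 a2 :
  (forall r, line_bundle (Ls r)) ->
  (forall r, good_representation nu (mul_t D (L := Ls r))
               (G r) (a0 r) (a1 r) (a2 r)) ->
  present_pushforwards phi Ls U xi
    (fun r => K_plus D nu (G r) (a0 r) (a1 r))
    (fun r => K_minus D nu xi (G r) (a0 r) (a1 r)).
Proof.
move=> lL gr.
have ex r := good_representation_transition1 (lL r) (gr r).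
(* The multipliers are fixed for each r before the exponents n are given: the same K's must serve
   all n. *)
pose u r := projT1 (cid (ex r)).
have ex' r : exists v, [/\ has_transition1 W (Ls r) (u r),
      forall E', is_dual (Ls r) E' -> has_transition1 W E' v,
      forall i j, unit_on (W i `&` W j) (v i j),
      forall i j, mul_matrix D (nu i) (U i `&` U j) (u r i j)
                    (K_plus D nu (G r) (a0 r) (a1 r) i j)
    & forall i j, mul_matrix D (nu i) (U i `&` U j) (v i j)
                    (K_minus D nu xi (G r) (a0 r) (a1 r) i j)].
  exact: (projT2 (cid (ex r))).
have [v vP] := choice ex'.
split=> [r i j|n P mP].
  have [tu _ uv uK vK] := vP r.
  split.
    have [_ uu] := has_transition1_unit i j tu.
    exact: (mul_matrix_GL (transition_frame1 i) (oUI i j) (@subIsetl _ _ _) uu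
      (uK i j)).
  exact: (mul_matrix_GL (transition_frame1 i) (oUI i j) (@subIsetl _ _ _) (uv i j)
    (vK i j)).
have [||w tw] := @monomial_transition1 _ _ _ W _ Ls n u v P oW _ _ mP.
- by move=> r; case: (vP r).
- by move=> r; case: (vP r).
exists (fun i => push_frame D (nu i) (w i)).
apply: (push_transition_by tw) => i j.
apply: (@mul_matrix_prod _ _ _ _ _ D _ (nu i) (transition_frame1 i) _ _ _
  (fun r x => (if 0 <= n r then u r i j x else v r i j x) ^+ `|n r|%N)
  (fun r y => (if 0 <= n r then K_plus D nu (G r) (a0 r) (a1 r) i j y
     else K_minus D nu xi (G r) (a0 r) (a1 r) i j y) ^+ `|n r|%N)) => //.
move=> r; have [_ _ _ uK vK] := vP r.
have pow := @mul_matrixX _ _ _ _ _ D _ _ (transition_frame1 i) _ _ _ `|n r|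
  (oUI i j) (@subIsetl _ _ _).
by case: (0 <= n r); [exact: pow (uK i j)|exact: pow (vK i j)].
Qed.

End GoodRepresentation.

End PushforwardTransitions.

(** * Existence of good representations over a common affine covering *)

Section GoodCovers.
Variables (k : closedFieldType) (X Y : variety k) (phi : morphism X Y).

Lemma frame_transition1 (Z : fun_space k) (E : modsheaf Z) (I : Type)
    (W : I -> set Z) (e : forall i, sec E (W i)) : (forall i, frame1 (e i)) ->
  transition1 e (fun i j => fcoef (e i) (res (W i `&` W j) (e j))).
Proof.
move=> fe; split=> // i j.
have oI := openI (frame1_open (fe i)) (frame1_open (fe j)).
have [rc eC] := fcoefP (fe i) (res (W i `&` W j) (e j)) oI (@subIsetl _ _ _).
by split.
Qed.

Lemma transition1_by (Z : fun_space k) (E : modsheaf Z) (I : Type)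
    (W : I -> set Z) (e : forall i, sec E (W i)) u : transition1 e u ->
  transition_by (fun i (_ : 'I_1) => e i) (fun i j x => (u i j x)%:M : 'M_1).
Proof.
move=> te; have [fe ue] := te; have tE : has_transition1 W E u by exists e.
split=> // [i j|i j b].
  have [oI [ru [v rv uv]]] := has_transition1_unit i j tE.
  have reg f : regfun Z (W i `&` W j) f ->
      forall a b, regfun Z (W i `&` W j) (fun x => ((f x)%:M : 'M_1) a b).
    move=> rf a b; apply: eq_regfun rf => // x _.
    by rewrite mxE (ord1 a) (ord1 b).
  split; first exact: reg.
  exists (fun x => (v x)%:M); first exact: reg.
  by move=> x Wx; rewrite -scalar_mxM uv.
rewrite big_ord1; have [ru ->] := ue i j.
have oI := openI (frame1_open (fe i)) (frame1_open (fe j)).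
by apply: eq_act => // x _; rewrite mxE (ord1 b).
Qed.

Lemma common_frame_neighborhood (N : modsheaf Y) m (Ls : 'I_m -> modsheaf X) y :
  line_bundle N ->
  (forall r, exists (V : set Y) (e : sec (Ls r) (phi @^-1` V)),
     [/\ open V, V y & frame1 e]) ->
  exists A : set Y, [/\ affine_open A, A y, exists nu : sec N A, frame1 nu
    & forall r, exists s : sec (Ls r) (phi @^-1` A), frame1 s].
Proof.
move=> lN loc; have [B [nu [By fnu]]] := lN y.
have oB := frame1_open fnu.
have [V [oV Vy Vs]] : exists V : set Y, [/\ open V, V y &
    forall r, r \in enum 'I_m -> exists s : sec (Ls r) (phi @^-1` V), frame1 s].
  elim: (enum 'I_m) => [|r rs [V [oV Vy Vs]]].
    by exists setT; split=> //; exact: openT.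
  have [V1 [e [oV1 V1y fe]]] := loc r.
  exists (V `&` V1); split=> //; first exact: openI.
  have oI : open (phi @^-1` (V `&` V1)) by apply: open_preimage; exact: openI.
  move=> r'; rewrite inE => /orP[/eqP ->|/Vs[s fs]].
    by exists (res (phi @^-1` (V `&` V1)) e); apply: frame1_res => // x [].
  by exists (res (phi @^-1` (V `&` V1)) s); apply: frame1_res => // x [].
have [A [aA Ay AVB]] := affine_basis (openI oV oB) (conj Vy By).
have [oA _] := aA; exists A; split=> //.
  by exists (res A nu); apply: frame1_res => // x /AVB[].
move=> r; have [|s fs] := Vs r; first by rewrite mem_enum.
exists (res (phi @^-1` A) s); apply: frame1_res => //; first exact: open_preimage.
by move=> x /AVB[].
Qed.

(* The frame of phi_* E is (s, t s). *)
Lemma frame1_good_representation (N : modsheaf Y) (D : double_cover_structure phi N)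
    (I : Type) (U : I -> set Y) (nu : forall i, sec N (U i)) xi
    (E : modsheaf X) (s : forall i, sec E (phi @^-1` U i)) :
  transition_by (fun i (_ : 'I_1) => nu i)
    (fun i j y => (xi i j y)%:M : 'M_1) ->
  (forall i, frame1 (s i)) ->
  exists G a0 a1 a2, good_representation nu (mul_t D (L := E)) G a0 a1 a2.
Proof.
move=> nu_xi fs; have fnu := transition_frame1 nu_xi.
have oU i := frame1_open (fnu i).
have ts := frame_transition1 fs.
set u := fun i j => fcoef _ _ in ts.
have ex (ij : I * I) : exists K,
    mul_matrix D (nu ij.1) (U ij.1 `&` U ij.2) (u ij.1 ij.2) K.
  case: ij => i j /=; have [_ /(_ i j)[ru _]] := ts.
  have oI := openI (oU i) (oU j).
  have [p [q [rp rq uE]]] := frame_split D (fnu i) oI (@subIsetl _ _ _) ru.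
  by exists (fun y => (p y)%:M + q y *: mx2 0 (branch_eq D (nu i) (nu i) y) 1 0), p, q.
have [K KP] := choice ex.
(* In the frame (s, t s), t sends s to t s and t s to F s. So M_i is M_i^(0), and a1 = 1 is a
   unit. *)
exists (fun i j y => K (i, j) y *m mx2 1 0 0 (xi i j y)),
  (fun _ _ => 0), (fun _ _ => 1), (F_loc D nu).
split; last first.
  move=> i; split; first exact: regfun_cst.
  by exists (fun=> 1) => [|x _]; [exact: regfun_cst|rewrite mulr1].
exists (fun i => push_frame D (nu i) (s i)); split=> [|i|i b].
- by apply: (push_transition_by nu_xi ts) => i j; exact: KP (i, j).
- split; [exact: regfun_cst|exact: regfun_cst|].
  exact: (branch_eq_regfun D (fnu i) (oU i) (@subset_refl _ _)).
have oW : open (phi @^-1` U i) by exact: open_preimage.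
have rt : regfun X (phi @^-1` U i) (tau D (nu i)) by exact: tau_regfun.
rewrite /mul_t sum_ord2 /push_frame /=.
have rF : regfun X (phi @^-1` U i) (F_loc D nu i \o phi).
  apply: morph_regfun => //.
  exact: (branch_eq_regfun D (fnu i) (oU i) (@subset_refl _ _)).
case: (ord2P b) => -> /=.
  rewrite [X in X + _]act_l0//; last by move=> x _ /=; rewrite mx2E mxE.
  rewrite add0r -[LHS]act1//; apply: eq_act => // x _ /=.
  by rewrite mx2E mxE.
rewrite [X in _ + X]act_l0//; last by move=> x _ /=; rewrite mx2E mxE oppr0.
rewrite addr0 -actM//; apply: eq_act => // x Ux /=.
by rewrite mx2E mxE/= /F_loc -(tau_sqr D (fnu i) Ux).
Qed.

End GoodCovers.

Lemma O_minus_line_bundle (k : closedFieldType) (Y : fun_space k)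
    (L : cartier_divisor Y) (N : modsheaf Y) : is_O_minus L N -> line_bundle N.
Proof.
move=> [u _ [e [fe _ _]]] y.
have [a _ ay] : (\bigcup_a div_dom (c := L) a) y by rewrite div_cover.
exists (div_dom a), (e a 0); split=> //.
have := fe a; rewrite /frame1; congr (frame _).
by apply/funext => i; rewrite ord1.
Qed.

Theorem theorem1p1 (R : realType) (X Y : variety R[i]) (phi : morphism X Y)
    (hphi : nonsingular_double_cover phi)
    (L : cartier_divisor Y) (N : modsheaf Y) (hN : is_O_minus L N)
    (D : double_cover_structure phi N)
    (m : nat) (Ls : 'I_m -> modsheaf X) (hLs : forall r, line_bundle (Ls r)) :
  (exists (I : Type) (U : I -> set Y) (xi : I -> I -> Y -> R[i])
      (Kp Km : 'I_m -> I -> I -> Y -> 'M[R[i]]_2),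
    [/\ affine_cover U,
        transition_functions N U (fun i j y => (xi i j y)%:M : 'M_1)
      & present_pushforwards phi Ls U xi Kp Km]) /\
  (forall (I : Type) (U : I -> set Y) (nu : forall i, sec N (U i))
      (xi : I -> I -> Y -> R[i])
      (G : 'I_m -> I -> I -> Y -> 'M[R[i]]_2)
      (a0 a1 a2 : 'I_m -> I -> Y -> R[i]),
    affine_cover U ->
    transition_by (fun i (_ : 'I_1) => nu i)
      (fun i j y => (xi i j y)%:M : 'M_1) ->
    (forall r, good_representation nu (mul_t D (L := Ls r))
                 (G r) (a0 r) (a1 r) (a2 r)) ->
    present_pushforwards phi Ls U xi
      (fun r => K_plus D nu (G r) (a0 r) (a1 r))
      (fun r => K_minus D nu xi (G r) (a0 r) (a1 r))).
Proof.
have [_ _ fin surj _] := hphi.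
have present (I : Type) (U : I -> set Y) (nu : forall i, sec N (U i)) xi
    (G : 'I_m -> I -> I -> Y -> 'M[R[i]]_2) a0 a1 a2 :
    transition_by (fun i (_ : 'I_1) => nu i) (fun i j y => (xi i j y)%:M : 'M_1) ->
    (forall r, good_representation nu (mul_t D (L := Ls r))
                 (G r) (a0 r) (a1 r) (a2 r)) ->
    present_pushforwards phi Ls U xi
      (fun r => K_plus D nu (G r) (a0 r) (a1 r))
      (fun r => K_minus D nu xi (G r) (a0 r) (a1 r)).
  by move=> nu_xi; exact: good_representation_present.
split; last by move=> I U nu xi G a0 a1 a2 _; exact: present.
have loc y : exists A : set Y, [/\ affine_open A, A y,
    exists nu : sec N A, frame1 nu
  & forall r, exists s : sec (Ls r) (phi @^-1` A), frame1 s].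
  apply: common_frame_neighborhood; first exact: O_minus_line_bundle hN.
  by move=> r; exact: (line_bundle_push_frame D).
(* The covering is indexed by the points of Y, each with a chosen neighborhood of its own. *)
have [U UP] := choice loc.
have exnu y : exists nu : sec N (U y), frame1 nu by case: (UP y).
have exs r y : exists s : sec (Ls r) (phi @^-1` U y), frame1 s.
  by case: (UP y).
pose nu y := projT1 (cid (exnu y)).
have fnu y : frame1 (nu y) by exact: (projT2 (cid (exnu y))).
pose s r y := projT1 (cid (exs r y)).
have fs r y : frame1 (s r y) by exact: (projT2 (cid (exs r y))).
have [xi tnu] : exists xi, transition_by (fun i (_ : 'I_1) => nu i)
    (fun i j y => (xi i j y)%:M : 'M_1).
  by eexists; exact: transition1_by (frame_transition1 fnu).
have good r : exists Ga : (Y -> Y -> Y -> 'M[R[i]]_2) *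
    ((Y -> Y -> R[i]) * (Y -> Y -> R[i]) * (Y -> Y -> R[i])),
    good_representation nu (mul_t D (L := Ls r)) Ga.1 Ga.2.1.1 Ga.2.1.2 Ga.2.2.
  have [G [a0 [a1 [a2 g]]]] := frame1_good_representation D tnu (fs r).
  by exists (G, (a0, a1, a2)).
have [Ga GaP] := choice good.
exists Y, U, xi.
eexists; eexists; split; last exact: present tnu GaP.
- split; first by move=> y; case: (UP y).
  by apply/seteqP; split=> // y _; exists y => //; case: (UP y).
- by exists (fun y _ => nu y).
Qed.
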